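(* Suppose that $(G,P,\theta)$ is an algebraic dynamical system with $G$ and $P$ abelian, and $2\leq[G:\theta_p(G)]<\infty$ for some $p\in P$. Let $T$ be the Pontryagin dual of the Grothendieck group $P^{-1}P$. If $C^*(G)\subset\mathcal{Q}(G\rtimes_\theta P)$ is maximal abelian and the only $\chi\in T$ for which the system of functional equations $$\chi(p)f=f\circ\widehat{\theta_p}\quad\text{for all }p\in P\text{ with }[G:\theta_p(G)]<\infty$$ admits a solution $f$ in $C(\widehat{G},\mathbb{T})$ is $\chi=1$, then the gauge action $\gamma\colon T\curvearrowright\mathcal{Q}(G\rtimes_\theta P)$ is an outer action.
   Context: An algebraic dynamical system is a triple $(G,P,\theta)$ where $G$ is a countable discrete group; $P$ is a right LCM semigroup, i.e. a countable left cancellative monoid in which the intersection of two principal right ideals is either empty or another principal right ideal; and $\theta$ is an action of $P$ on $G$ by injective group endomorphisms $\theta_p$ which respects the order: $pP\cap qP=rP$ implies $\theta_p(G)\cap\theta_q(G)=\theta_r(G)$. Write $N_p=[G:\theta_p(G)]$. An abelian $P$ is directed with respect to $p\geq q\Leftrightarrow p\in qP$. For directed $P$, the boundary quotient $\mathcal{Q}(G\rtimes_\theta P)$ is the universal $C^*$-algebra generated by a unitary representation $u$ of $G$ and a representation $s$ of the monoid $P$ by isometries satisfying (I) $s_pu_g=u_{\theta_p(g)}s_p$; (II) $s_p^*u_gs_q=u_{g_1}s_{p'}s_{q'}^*u_{g_2}$ if $g=\theta_p(g_1)\theta_q(g_2)$ and $pP\cap qP=pp'P$, $pp'=qq'$,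 and $s_p^*u_gs_q=0$ otherwise; (III) $\sum_{[g]\in G/\theta_p(G)}u_gs_ps_p^*u_g^*=1$ whenever $N_p<\infty$. $C^*(G)$ is identified with the $C^*$-subalgebra of $\mathcal{Q}(G\rtimes_\theta P)$ generated by $\{u_g\mid g\in G\}$. $\widehat{G}$ is the Pontryagin dual of $G$, and $\widehat{\theta_p}$ is the surjective group endomorphism of $\widehat{G}$ dual to $\theta_p$, i.e. $\widehat{\theta_p}(\eta)=\eta\circ\theta_p$. The gauge action is $\gamma_\chi(u_gs_p)=\chi(p)u_gs_p$ for $\chi\in T$, $g\in G$, $p\in P$. An action is outer if every non-trivial group element acts by an automorphism that is not of the form ${\rm Ad}(w)$ for a unitary $w$ in the algebra. *)

(* Defs.v *)
(* The complex numbers are [R[i]] for [R : realType]; the definitions below take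
   them as a [numClosedFieldType] [K]. *)
From HB Require Import structures.
From mathcomp Require Import all_boot all_order all_algebra.
From mathcomp Require Import finmap.
From mathcomp Require Export complex.
From mathcomp Require Import all_classical all_reals all_analysis.

Set Implicit Arguments.
Unset Strict Implicit.
Unset Printing Implicit Defensive.

Import Order.TTheory GRing.Theory Num.Theory.
Import numFieldNormedType.Exports.

Local Open Scope classical_set_scope.
Local Open Scope quotient_scope.
Local Open Scope ring_scope.

(** ** Unital C*-algebras *)

(* The joins needed to extend both [GRing.Algebra] and [NormedModule] are
   missing from the library hierarchy; the norm is therefore a field of the
   structures below, and the library topology lives on the copy [normed_space]
   of the carrier. *)
HB.mixin Record isNormedAlgebra (K : numClosedFieldType) A
    & GRing.Algebra K A := {
  anorm : A -> K;
  anormD : forall x y : A, anorm (x + y) <= anorm x + anorm y;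
  anormZ : forall (a : K) (x : A), anorm (a *: x) = `|a| * anorm x;
  anorm0_eq0 : forall x : A, anorm x = 0 -> x = 0;
  anormM : forall x y : A, anorm (x * y) <= anorm x * anorm y
}.

#[short(type="normedAlgType")]
HB.structure Definition NormedAlgebra (K : numClosedFieldType) :=
  {A of isNormedAlgebra K A & GRing.Algebra K A}.

Definition normed_space (K : numClosedFieldType) (A : normedAlgType K) : Type :=
  A.

Section NormedSpace.
Variables (K : numClosedFieldType) (A : normedAlgType K).

HB.instance Definition _ := GRing.Lmodule.copy (normed_space A) A.
HB.instance Definition _ := Lmodule_isNormed.Build K (normed_space A)
  (@anormD K A) (@anormZ K A) (@anorm0_eq0 K A).

End NormedSpace.

HB.mixin Record NormedAlgebra_isCstar (K : numClosedFieldType) A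
    & NormedAlgebra K A := {
  anorm_complete : forall F : set_system (normed_space A),
    ProperFilter F -> cauchy F -> cvg F;
  star : A -> A;
  starK : involutive star;
  starD : {morph star : x y / x + y};
  starZ : forall (a : K) (x : A), star (a *: x) = a^* *: star x;
  starM : forall x y : A, star (x * y) = star y * star x;
  cstar_identity : forall x : A, anorm (star x * x) = anorm x ^+ 2
}.

(* [algType] has [1 != 0], so these are the nonzero unital C*-algebras. The
   zero algebra receives exactly one morphism from any algebra, so leaving it
   out does not affect universal properties. *)
#[short(type="cstarAlgType")]
HB.structure Definition CstarAlgebra (K : numClosedFieldType) :=
  {A of NormedAlgebra_isCstar K A & NormedAlgebra K A}.

Section Cstar.
Context {K : numClosedFieldType}.
Implicit Types A B : cstarAlgType K.

Definition unitary A (w : A) : Prop := star w * w = 1 /\ w * star w = 1.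

(* [{lrmorphism A -> B}] is the type of unital algebra morphisms. *)
Definition star_morphism A B (phi : {lrmorphism A -> B}) : Prop :=
  forall x, phi (star x) = star (phi x).

Record cstar_subalgebra A (D : set A) : Prop := CstarSubalgebra {
  csub0 : D 0;
  csubD : forall x y, D x -> D y -> D (x + y);
  csubZ : forall (a : K) x, D x -> D (a *: x);
  csubM : forall x y, D x -> D y -> D (x * y);
  csub_star : forall x, D x -> D (star x);
  csub_closed : closed (D : set (normed_space A))
}.

Definition cstar_generated A (S : set A) : set A :=
  smallest (@cstar_subalgebra A) S.

Definition commutative_set A (D : set A) : Prop :=
  forall x y, D x -> D y -> x * y = y * x.

Definition maximal_abelian A (D : set A) : Prop :=
  [/\ cstar_subalgebra D, commutative_set D &
      forall E : set A, cstar_subalgebra E -> commutative_set E ->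
        D `<=` E -> E = D].

Definition group_action (T : groupType) A (gamma : T -> {lrmorphism A -> A}) :
    Prop :=
  [/\ forall t, star_morphism (gamma t),
      forall a, gamma 1%g a = a &
      forall t t' a, gamma (t * t')%g a = gamma t (gamma t' a)].

Definition outer_action (T : groupType) A (gamma : T -> {lrmorphism A -> A}) :
    Prop :=
  group_action gamma /\
  forall t, t <> 1%g ->
    ~ exists w : A, unitary w /\ forall a, gamma t a = w * a * star w.

End Cstar.

(** ** Pontryagin dual of a discrete group *)

Section Dual.
Variables (K : numClosedFieldType) (G : groupType).

(* Continuity is automatic, [G] being discrete. *)
Definition characters : set {compact-open, discrete_topology G -> K} :=
  [set chi : G -> K | (forall g h, chi (g * h)%g = chi g * chi h) /\
                      (forall g, `|chi g| = 1)].

Definition pontryagin : Type := set_type characters.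

HB.instance Definition _ := Topological.on pontryagin.

Definition char_fun (chi : pontryagin) : G -> K := set_val chi.
Coercion char_fun : pontryagin >-> Funclass.

Lemma charM (chi : pontryagin) g h : chi (g * h)%g = chi g * chi h.
Proof. by case: chi => c cP; exact: (set_mem cP).1. Qed.

Lemma norm_char (chi : pontryagin) g : `|chi g| = 1.
Proof. by case: chi => c cP; exact: (set_mem cP).2. Qed.

Lemma char_neq0 (chi : pontryagin) g : chi g != 0.
Proof. by rewrite -normr_eq0 norm_char oner_eq0. Qed.

Lemma pdual_eqP (chi psi : pontryagin) : chi =1 psi -> chi = psi.
Proof. by move=> e; apply: val_inj; apply/funext. Qed.

Definition mk_char (f : G -> K) (fM : forall g h, f (g * h)%g = f g * f h)
    (f1 : forall g, `|f g| = 1) : pontryagin :=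
  SigSub (mem_set (conj fM f1 : characters f)).

Definition pdual_one : pontryagin.
Proof.
by apply: (@mk_char (fun=> 1)) => *; rewrite ?mulr1 ?normr1.
Defined.

Definition pdual_mul (chi psi : pontryagin) : pontryagin.
Proof.
apply: (@mk_char (fun g => chi g * psi g)) => [g h|g].
  by rewrite !charM mulrACA.
by rewrite normrM !norm_char mulr1.
Defined.

Definition pdual_inv (chi : pontryagin) : pontryagin.
Proof.
apply: (@mk_char (fun g => (chi g)^-1)) => [g h|g].
  by rewrite charM invfM.
by rewrite normfV norm_char invr1.
Defined.

Fact pdual_mulA : associative pdual_mul.
Proof. by move=> x y z; apply: pdual_eqP => g; exact: mulrA. Qed.
Fact pdual_mul1 : left_id pdual_one pdual_mul.
Proof. by move=> x; apply: pdual_eqP => g; exact: mul1r. Qed.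
Fact pdual_mulr1 : right_id pdual_one pdual_mul.
Proof. by move=> x; apply: pdual_eqP => g; exact: mulr1. Qed.
Fact pdual_mulV : left_inverse pdual_one pdual_inv pdual_mul.
Proof.
by move=> x; apply: pdual_eqP => g; exact: (mulVf (char_neq0 x g)).
Qed.
Fact pdual_mulrV : right_inverse pdual_one pdual_inv pdual_mul.
Proof.
by move=> x; apply: pdual_eqP => g; exact: (mulfV (char_neq0 x g)).
Qed.

HB.instance Definition _ := isGroup.Build pontryagin
  pdual_mulA pdual_mul1 pdual_mulr1 pdual_mulV pdual_mulrV.

Definition pdual_map (f : {multiplicative G -> G}) (eta : pontryagin) :
  pontryagin.
Proof.
apply: (@mk_char (eta \o f)) => [g h|g] /=.
  by rewrite gmulfM charM.
exact: norm_char.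
Defined.

End Dual.

(** ** Grothendieck group of a commutative monoid *)

Section Grothendieck.
Variable P : monoidType.
Hypothesis PC : commutative (@monoid.mul P).

(* [(p, q)] stands for the fraction [q^-1 p]. *)
Definition groth_rel : rel (P * P) := fun x y =>
  `[< exists k, (k * (x.1 * y.2) = k * (y.1 * x.2))%g >].

Let mulCA (x y z : P) : (x * (y * z) = y * (x * z))%g.
Proof. by rewrite !mulgA (PC x y). Qed.

Let mulACA (x y z t : P) : ((x * y) * (z * t) = (x * z) * (y * t))%g.
Proof. by rewrite -!mulgA (mulCA y). Qed.

Let mulAC5 (a b c d e : P) :
  (a * b * c * (d * e) = (b * e) * (a * (d * c)))%g.
Proof.
have bE x : (b * e * (a * x) = a * (b * (e * x)))%g.
  by rewrite mulCA -mulgA.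
rewrite bE -!mulgA.
by rewrite (PC d c) (mulCA e c) (PC e d).
Qed.

Fact groth_rel_equiv : equiv_class_of groth_rel.
Proof.
split=> [x|x y|y x z].
- by apply/asboolP; exists 1%g.
- by apply/asbool_equiv_eq; split=> -[k e]; exists k.
- move=> /asboolP[k e] /asboolP[l e']; apply/asboolP; exists (k * l * y.2)%g.
  rewrite mulAC5 e [in RHS](PC k l) [RHS]mulAC5 -e'.
  rewrite [LHS]mulACA [RHS]mulACA (PC k l); congr monoid.mul.
  by rewrite mulCA [RHS]mulCA (PC z.2).
Qed.

Canonical groth_equiv := EquivRelPack groth_rel_equiv.

Definition grothendieck : Type := {eq_quot groth_rel}.

HB.instance Definition _ := Choice.on grothendieck.

Definition groth_frac (p q : P) : grothendieck :=
  \pi_{eq_quot groth_rel} (p, q).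

Definition groth_in (p : P) : grothendieck := groth_frac p 1%g.

Lemma groth_fracP p q p' q' :
  groth_frac p q = groth_frac p' q' <->
  exists k, (k * (p * q') = k * (p' * q))%g.
Proof.
split=> [/eqmodP/asboolP //|h].
by apply/eqmodP/asboolP.
Qed.

Lemma grothW (Q : grothendieck -> Prop) :
  (forall p q, Q (groth_frac p q)) -> forall x, Q x.
Proof. by move=> h x; rewrite -[x]reprK; case: (repr x). Qed.

Definition groth_mul (x y : grothendieck) : grothendieck :=
  groth_frac ((repr x).1 * (repr y).1)%g ((repr x).2 * (repr y).2)%g.

Definition groth_inv (x : grothendieck) : grothendieck :=
  groth_frac (repr x).2 (repr x).1.

Let repr_frac p q : exists k,
  (k * ((repr (groth_frac p q)).1 * q) = k * (p * (repr (groth_frac p q)).2))%g.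
Proof.
apply/groth_fracP; rewrite /groth_frac -surjective_pairing.
exact: reprK.
Qed.

Lemma groth_mulE p q p' q' :
  groth_mul (groth_frac p q) (groth_frac p' q') =
  groth_frac (p * p')%g (q * q')%g.
Proof.
have [k e] := repr_frac p q; have [l e'] := repr_frac p' q'.
apply/groth_fracP; exists (k * l)%g.
rewrite [(_ * _ * (q * q'))%g]mulACA mulACA e e' -mulACA.
by congr monoid.mul; exact: mulACA.
Qed.

Lemma groth_invE p q : groth_inv (groth_frac p q) = groth_frac q p.
Proof.
have [k e] := repr_frac p q; apply/groth_fracP; exists k.
by rewrite (PC q) e (PC p).
Qed.

Fact groth_mulA : associative groth_mul.
Proof.
move=> x y z; move: x; apply: grothW => p q; move: y; apply: grothW => p' q'.
move: z; apply: grothW => p'' q''.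
by rewrite !groth_mulE !mulgA.
Qed.

Fact groth_mul1 : left_id (groth_in 1%g) groth_mul.
Proof. by apply: grothW => p q; rewrite groth_mulE !mul1g. Qed.

Fact groth_mulr1 : right_id (groth_in 1%g) groth_mul.
Proof. by apply: grothW => p q; rewrite groth_mulE !mulg1. Qed.

Fact groth_mulV : left_inverse (groth_in 1%g) groth_inv groth_mul.
Proof.
apply: grothW => p q; rewrite groth_invE groth_mulE.
apply/groth_fracP.
by exists 1%g; rewrite !mulg1 !mul1g PC.
Qed.

Fact groth_mulrV : right_inverse (groth_in 1%g) groth_inv groth_mul.
Proof.
apply: grothW => p q; rewrite groth_invE groth_mulE.
apply/groth_fracP.
by exists 1%g; rewrite !mulg1 !mul1g PC.
Qed.

HB.instance Definition _ := isGroup.Build grothendieck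
  groth_mulA groth_mul1 groth_mulr1 groth_mulV groth_mulrV.

End Grothendieck.

(** ** Algebraic dynamical systems and the boundary quotient *)

Section ADS.
Variables (G : groupType) (P : monoidType).
Implicit Type theta : P -> {multiplicative G -> G}.

Definition principal_right_ideal (p : P) : set P := range (monoid.mul p).

Record right_LCM : Prop := RightLCM {
  lcm_countable : countable [set: P];
  lcm_cancel : forall p : P, injective (monoid.mul p);
  lcm_ideals : forall p q : P,
    principal_right_ideal p `&` principal_right_ideal q = set0 \/
    exists r, principal_right_ideal p `&` principal_right_ideal q =
              principal_right_ideal r
}.

Record algebraic_dynamical_system theta : Prop := AlgebraicDynamicalSystem {
  ads_countable : countable [set: G];
  ads_monoid : right_LCM;
  ads_inj : forall p, injective (theta p);
  ads1 : forall g, theta 1%g g = g;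
  adsM : forall p q g, theta (p * q)%g g = theta p (theta q g);
  ads_order : forall p q r,
    principal_right_ideal p `&` principal_right_ideal q =
      principal_right_ideal r ->
    range (theta p) `&` range (theta q) = range (theta r)
}.

Definition cosets theta (p : P) : set (set G) :=
  range (fun g => [set (g * h)%g | h in range (theta p)]).

Definition finite_index theta (p : P) : Prop := finite_set (cosets theta p).

Definition theta_index theta (p : P) : nat := #|` fset_set (cosets theta p)|.

(* The data [g1, g2, p', q'] occurring in relation (II). *)
Definition admissible theta (p q : P) (g g1 g2 : G) (p' q' : P) : Prop :=
  [/\ g = (theta p g1 * theta q g2)%g,
      principal_right_ideal p `&` principal_right_ideal q =
        principal_right_ideal (p * p')%g &
      (p * p' = q * q')%g].

Record boundary_relations theta (K : numClosedFieldType) (A : cstarAlgType K)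
    (u : G -> A) (s : P -> A) : Prop := BoundaryRelations {
  rel_unitary : forall g, unitary (u g);
  rel_u1 : u 1%g = 1;
  rel_uM : forall g h, u (g * h)%g = u g * u h;
  rel_isometry : forall p, star (s p) * s p = 1;
  rel_s1 : s 1%g = 1;
  rel_sM : forall p q, s (p * q)%g = s p * s q;
  rel_I : forall p g, s p * u g = u (theta p g) * s p;
  rel_II : forall p q g g1 g2 p' q',
    admissible theta p q g g1 g2 p' q' ->
    star (s p) * u g * s q = u g1 * s p' * star (s q') * u g2;
  rel_II0 : forall p q g,
    ~ (exists g1 g2 p' q', admissible theta p q g g1 g2 p' q') ->
    star (s p) * u g * s q = 0;
  (* By [rel_I] the summand does not depend on the representative [g] of the
     coset [X]. *)
  rel_III : forall p, finite_index theta p ->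
    \sum_(X \in cosets theta p)
      (let g := xget 1%g X in u g * s p * star (s p) * star (u g)) = 1
}.

(* [(A, u, s)] is the universal C*-algebra [Q(G x_theta P)] together with its
   canonical generators; this determines it up to unique isomorphism. *)
Record boundary_quotient theta (K : numClosedFieldType) (A : cstarAlgType K)
    (u : G -> A) (s : P -> A) : Prop := BoundaryQuotient {
  bq_relations : boundary_relations theta u s;
  bq_generated : cstar_generated (range u `|` range s) = [set: A];
  bq_universal : forall (B : cstarAlgType K) (v : G -> B) (t : P -> B),
    boundary_relations theta v t ->
    exists phi : {lrmorphism A -> B},
      [/\ star_morphism phi, forall g, phi (u g) = v g,
          forall p, phi (s p) = t p &
          forall psi : {lrmorphism A -> B}, star_morphism psi ->
            (forall g, psi (u g) = v g) -> (forall p, psi (s p) = t p) ->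
            psi =1 phi]
}.

Definition gauge_action (PC : commutative (@monoid.mul P))
    (K : numClosedFieldType) (A : cstarAlgType K) (u : G -> A) (s : P -> A)
    (gamma : pontryagin K (grothendieck PC) -> {lrmorphism A -> A}) : Prop :=
  forall chi, star_morphism (gamma chi) /\
    forall g p, gamma chi (u g * s p) = chi (groth_in PC p) *: (u g * s p).

(* [chi(p) f = f o theta_p^] for all [p] of finite index, with [f] in
   [C(G^, T)] and [T] the unit circle of [K]. *)
Definition functional_equations theta (PC : commutative (@monoid.mul P))
    (K : numClosedFieldType) (chi : pontryagin K (grothendieck PC))
    (f : pontryagin K G -> K) : Prop :=
  [/\ continuous f, forall eta, `|f eta| = 1 &
      forall p, finite_index theta p -> forall eta,
        chi (groth_in PC p) * f eta = f (pdual_map (theta p) eta)].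

End ADS.

(* Main.v *)
Require Import Defs.
From HB Require Import structures.
From mathcomp Require Import all_boot all_order all_algebra finmap.
From mathcomp Require Import all_classical all_reals all_analysis.
From mathcomp Require Import ring lra.

(** Suppose that the gauge automorphism of chi is a -> w a (star w) for a unitary
    w. It fixes every u_g, so w commutes with C*(G) and lies in C*(G), which is
    maximal abelian ([maximal_abelian_commutant]). Its effect on s_p gives
    s_p v = chi(p) v s_p for v = star w. When theta_p has finite index, let
    Phi_p(a) be the sum of u_g s_p a (star s_p) (star u_g) over the cosets of
    theta_p(G). Then Phi_p(u_h) = u_(theta_p(h)) and, by relation (III),
    Phi_p(v) = chi(p) v. If elements of C*(G) are regarded as functions on the
    dual group, Phi_p is the composition with the dual of theta_p, so the
    function f of v is unimodular and solves the functional equations for chi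
    ([symbol_unimodular], [symbol_functional_equation]). By hypothesis chi = 1.

    To regard v as a continuous function on the whole dual group, one needs
    that the value of a sum of c_g u_g at any character eta, namely the sum of
    the c_g eta(g), has modulus at most the norm of that sum in the boundary
    quotient ([poly_eval_le_rnorm]); then f is the uniform limit of the values
    of sums that converge to v ([generated_symbol]). Such a bound requires a
    representation of the boundary quotient in which no character is lost. The
    Hilbert space of square summable functions on G carries one, given on basis
    vectors by u_g : h -> g h and s_p : h -> theta_p(h)
    ([l2_boundary_relations]). The universal property yields a star morphism
    from the quotient to the bounded operators on this space. It is contractive
    ([star_morphism_contractive]), because 1 - (star x) x has a selfadjoint
    square root when |x| < 1 ([selfadjoint_sqrt]).

    It remains to bound the values at characters by the norm of the operator
    a = sum of c_g lambda_g, where lambda is the regular representation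
    ([poly_eval_le]). Truncations of eta to the boxes of products of at most n
    copies of each g that occurs are eigenvectors of a away from the boundary
    of the box, and n applications of a to such a vector still produce the n-th
    power of the eigenvalue at the coordinate 1. The norm of the vector grows
    only polynomially in n because G is abelian, so the eigenvalue has modulus
    at most the norm of a.

    The C*-algebra of bounded operators is built for an arbitrary Hilbert space
    from pairs of mutually adjoint operators, and the Hilbert space from
    unordered sums over G. *)

Set Implicit Arguments.
Unset Strict Implicit.
Unset Printing Implicit Defensive.

Import Order.TTheory GRing.Theory Num.Theory.
Import numFieldNormedType.Exports.
Import ComplexField.Normc.

Local Open Scope classical_set_scope.
Local Open Scope ring_scope.
Local Open Scope complex_scope.

Local Notation Re := complex.Re.
Local Notation Im := complex.Im.

(** * The modulus of a complex number and limits of sequences *)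

Section Modulus.
Variable R : realType.
Implicit Types z w : R[i].

Lemma normCE z : `|z| = (normc z)%:C. Proof. by []. Qed.

Lemma normc_conj z : normc (z^*)%R = normc z.
Proof. by apply: complexI; rewrite -!normCE; exact: norm_conjC. Qed.

Lemma normc_ge0 z : 0 <= normc z.
Proof. by rewrite -lecR; exact: (@normr_ge0 _ R[i]). Qed.

Lemma normc_real (r : R) : normc r%:C = `|r|.
Proof. by rewrite /normc /= expr0n /= addr0 sqrtr_sqr. Qed.

Lemma normc_distC z w : normc (z - w) = normc (w - z).
Proof. by apply: complexI; rewrite -!normCE distrC. Qed.

Lemma normcX z n : normc (z ^+ n) = normc z ^+ n.
Proof. by elim: n => [|n ih]; rewrite ?expr0 ?normc1// !exprS normcM ih. Qed.

Lemma normc_sqr z : normc z ^+ 2 = Re z ^+ 2 + Im z ^+ 2.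
Proof. by case: z => a b /=; rewrite sqr_sqrtr// addr_ge0 ?sqr_ge0. Qed.

Lemma Re_le_normc z : `|Re z| <= normc z.
Proof.
rewrite -(@ler_pXn2r _ 2)// ?nnegrE ?normc_ge0//.
by rewrite normc_sqr real_normK ?num_real// lerDl sqr_ge0.
Qed.

Lemma Im_le_normc z : `|Im z| <= normc z.
Proof.
rewrite -(@ler_pXn2r _ 2)// ?nnegrE ?normc_ge0//.
by rewrite normc_sqr [_ ^+ 2]real_normK ?num_real// lerDr sqr_ge0.
Qed.

Lemma normc_le_ReIm z : normc z <= `|Re z| + `|Im z|.
Proof.
rewrite -(@ler_pXn2r _ 2)// ?nnegrE ?normc_ge0 ?addr_ge0//.
rewrite normc_sqr sqrrD !real_normK ?num_real//.
by rewrite lerD2r lerDl mulrn_wge0 ?mulr_ge0.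
Qed.

End Modulus.

Lemma complex_gt0 (R : realType) (e : R[i]) : 0 < e -> e = (Re e)%:C /\ 0 < Re e.
Proof.
move=> e0; have er : (Re e)%:C = e by rewrite RRe_real// gtr0_real.
by split=> //; rewrite -ltcR er.
Qed.

Lemma le0_of_eps (R : realType) (a : R) : (forall e : R, 0 < e -> a <= e) -> a <= 0.
Proof. by move=> h; apply/ler_addgt0Pr => e e0; rewrite add0r h. Qed.

Lemma le0_of_lim (R : realType) (a : R) (e : nat -> R) :
  e @ \oo --> 0 -> (forall n, a <= e n) -> a <= 0.
Proof.
move=> e0 ae; apply: le0_of_eps => d d0.
have /cvgrPdist_lt/(_ _ d0)[n _ /(_ n (leqnn _))] := e0.
rewrite sub0r normrN => en; rewrite (le_trans (ae n))// ltW//.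
by rewrite (le_lt_trans (ler_norm _)).
Qed.

Lemma cvgMl0 (R : realType) (c : R) (e : nat -> R) :
  e @ \oo --> 0 -> (fun n => c * e n) @ \oo --> 0.
Proof.
by move=> e0; rewrite -[X in _ --> X](mulr0 c); apply: cvgM => //; exact: cvg_cst.
Qed.

Lemma geom_cvg0 (R : realType) : (fun n => 2 * (2^-1 : R) ^+ n) @ \oo --> (0 : R).
Proof.
rewrite -[X in _ --> X](mulr0 2); apply: cvgM; first exact: cvg_cst.
by apply: cvg_expr; rewrite ger0_norm; lra.
Qed.

Lemma real_seq_complete (R : realType) (a e : nat -> R) : e @ \oo --> 0 ->
  (forall n m, (n <= m)%N -> `|a n - a m| <= e n) -> cvg (a @ \oo).
Proof.
move=> e0 ae; apply: cauchy_cvg; apply/cauchyP => d d0.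
have /cvgrPdist_lt/(_ _ d0)[n _ /(_ n (leqnn _))] := e0.
rewrite sub0r normrN => ed; exists (a n); exists n => // m /= nm.
by rewrite /ball/= (le_lt_trans (ae _ _ nm))// (le_lt_trans (ler_norm _)).
Qed.

Lemma complex_seq_complete (R : realType) (a : nat -> R[i]) (e : nat -> R) :
  e @ \oo --> 0 -> (forall n m, (n <= m)%N -> normc (a n - a m) <= e n) ->
  exists l, (fun m => normc (l - a m)) @ \oo --> (0 : R).
Proof.
move=> e0 ae.
have cre : cvg ((fun n => Re (a n)) @ \oo).
  apply: (real_seq_complete e0) => n m nm.
  by rewrite -raddfB (le_trans (Re_le_normc _))// ae.
have cim : cvg ((fun n => Im (a n)) @ \oo).
  apply: (real_seq_complete e0) => n m nm.
  by rewrite -raddfB (le_trans (Im_le_normc _))// ae.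
set r := lim _ in cre; set s := lim _ in cim.
exists (r +i* s)%C.
apply: (@squeeze_cvgr _ _ _ _ (fun=> 0)
  (fun m => `|r - Re (a m)| + `|s - Im (a m)|)).
- by near=> m; rewrite normc_ge0 (le_trans (normc_le_ReIm _))//; case: (a m).
- exact: cvg_cst.
- rewrite -[X in _ --> X]addr0 -{1}(normr0 R) -{2}(normr0 R).
  apply: cvgD; apply: cvg_norm.
    by rewrite -[X in _ --> X](subrr r); apply: cvgB => //; exact: cvg_cst.
  by rewrite -[X in _ --> X](subrr s); apply: cvgB => //; exact: cvg_cst.
Unshelve. all: by end_near. Qed.

(** * Real norms on normed algebras and C*-algebras *)

Section NormedAlgebraTheory.
Variables (R : realType) (A : normedAlgType R[i]).
Implicit Types x y : A.

(** The norm as a real number, so that estimates are made in an ordered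
    field. *)
Definition rnorm x : R := Re (anorm x).

Lemma anorm_normE x : anorm x = `|x : normed_space A|. Proof. by []. Qed.

Lemma anormE x : anorm x = (rnorm x)%:C.
Proof. by rewrite [RHS]RRe_real// anorm_normE; exact: normr_real. Qed.

Lemma rnorm_ge0 x : 0 <= rnorm x.
Proof. by rewrite -lecR -anormE anorm_normE; exact: normr_ge0. Qed.

Lemma rnormD x y : rnorm (x + y) <= rnorm x + rnorm y.
Proof. by rewrite -lecR rmorphD/= -!anormE; exact: anormD. Qed.

Lemma rnormM x y : rnorm (x * y) <= rnorm x * rnorm y.
Proof. by rewrite -lecR rmorphM/= -!anormE; exact: anormM. Qed.

Lemma rnormZ (a : R[i]) x : rnorm (a *: x) = normc a * rnorm x.
Proof. by apply: complexI; rewrite rmorphM/= -!anormE anormZ. Qed.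

Lemma rnorm0_eq0 x : rnorm x = 0 -> x = 0.
Proof. by move=> x0; apply: anorm0_eq0; rewrite anormE x0. Qed.

Lemma rnorm0 : rnorm 0 = 0.
Proof. by rewrite -(scale0r (0 : A)) rnormZ normc0 mul0r. Qed.

Lemma rnormN x : rnorm (- x) = rnorm x.
Proof. by rewrite -scaleN1r rnormZ -(rmorphN1 (real_complex R)) normc_real normrN1 mul1r. Qed.

Lemma rnorm_distC x y : rnorm (x - y) = rnorm (y - x).
Proof. by rewrite -rnormN opprB. Qed.

Lemma rnorm_triangle y x z : rnorm (x - z) <= rnorm (x - y) + rnorm (y - z).
Proof. by rewrite (le_trans _ (rnormD _ _))// addrA subrK. Qed.

Lemma ballE x y (e : R) : ball (x : normed_space A) e%:C (y : normed_space A) <->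
  rnorm (x - y) < e.
Proof. by rewrite -ball_normE /= -anorm_normE anormE ltcR. Qed.

Lemma nbhs_normedP x (U : set (normed_space A)) :
  nbhs (x : normed_space A) U <->
  exists2 e : R, 0 < e & forall y, rnorm (x - y) < e -> U y.
Proof.
split=> [/nbhs_ballP[e /= /complex_gt0[-> e0] eU]|[e e0 eU]].
  by exists (Re e) => // y /ballE /eU.
by apply/nbhs_ballP; exists e%:C => /=; [rewrite ltcR|move=> y /ballE /eU].
Qed.

Lemma closed_approx (E : set A) : closed (E : set (normed_space A)) <->
  forall x, (forall e : R, 0 < e -> exists2 y, E y & rnorm (x - y) < e) -> E x.
Proof.
split=> [cE x xE|cE x xE].
  apply: cE => U /nbhs_normedP[e e0 eU].
  by have [y Ey /eU Uy] := xE _ e0; exists y.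
apply: cE => e e0.
have [|y [Ey xy]] := xE (fun y => rnorm (x - y) < e); last by exists y.
by apply/nbhs_normedP; exists e.
Qed.

(** A Cauchy filter contains balls of radius 2^-n around points [x n]; these
    points form a Cauchy sequence, and the filter converges to its limit. *)
Lemma seq_completeP :
  (forall (x : nat -> A) (e : nat -> R), e @ \oo --> 0 ->
     (forall n m, (n <= m)%N -> rnorm (x n - x m) <= e n) ->
     exists l, forall n, rnorm (x n - l) <= e n) <->
  (forall F : set_system (normed_space A), ProperFilter F -> cauchy F -> cvg F).
Proof.
split=> [comp F FF /cauchyP cF|comp x e e0 xe].
  have gp n : 0 < (2^-1 : R) ^+ n by rewrite exprn_gt0// invr_gt0.
  have /choice[x xF] n : exists x : A, F (fun y => rnorm (x - y) < 2^-1 ^+ n).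
    have [|x xF] := cF ((2^-1 : R) ^+ n)%:C; first by rewrite ltcR.
    by exists x; apply: filterS xF => y /ballE.
  have [n m nm|l lP] := comp x (fun n => 2 * 2^-1 ^+ n) (@geom_cvg0 R).
    have [y [/= ny my]] := filter_ex (filterI (xF n) (xF m)).
    have le_mn : (2^-1 : R) ^+ m <= 2^-1 ^+ n.
      by rewrite ler_wiXn2l// ?invr_ge0// invf_le1// ler1n.
    rewrite rnorm_distC in my.
    by have := rnorm_triangle y (x n) (x m); lra.
  apply/cvg_ex; exists (l : normed_space A) => U /nbhs_normedP[e e0 eU].
  have /cvgrPdist_lt/(_ _ e0)[n _ /(_ n (leqnn _))] :
      (fun n => 2 * (2 * (2^-1 : R) ^+ n)) @ \oo --> (0 : R).
    rewrite -[X in _ --> X](mulr0 2); apply: cvgM; first exact: cvg_cst.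
    exact: geom_cvg0.
  rewrite sub0r normrN ger0_norm; last by rewrite !mulr_ge0// ltW.
  move=> ne; apply: filterS (xF n) => y ny; apply: eU.
  rewrite (le_lt_trans (rnorm_triangle (x n) _ _))// rnorm_distC.
  by have := lP n; lra.
have cx : cauchy (x @ \oo : set_system (normed_space A)).
  apply/cauchyP => d /complex_gt0[-> d0].
  have /cvgrPdist_lt/(_ _ d0)[n _ /(_ n (leqnn _))] := e0.
  rewrite sub0r normrN => ed; exists (x n); exists n => // m /= nm.
  by apply/ballE; rewrite (le_lt_trans (xe _ _ nm))// (le_lt_trans (ler_norm _)).
have [l lP] := (cvg_ex _).1 (comp _ _ cx); exists l => n.
apply/ler_addgt0Pr => d d0.
have [m _ mP] : (x @ \oo) (fun y => rnorm (l - y) < d).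
  by apply: lP; apply/nbhs_normedP; exists d.
have {}mP : rnorm (l - x (maxn n m)) < d by apply: mP; exact: leq_maxr.
rewrite (le_trans (rnorm_triangle (x (maxn n m)) _ _))// lerD//.
  by rewrite xe// leq_maxl.
by rewrite rnorm_distC ltW.
Qed.

End NormedAlgebraTheory.

Section CstarTheory.
Variables (R : realType) (A : cstarAlgType R[i]).
Implicit Types x y h : A.

Lemma star0 : star 0 = 0 :> A.
Proof. by rewrite -[in LHS](scale0r (0 : A)) starZ rmorph0 scale0r. Qed.

Lemma starN x : star (- x) = - star x.
Proof. by rewrite -scaleN1r starZ rmorphN1 scaleN1r. Qed.

Lemma starB x y : star (x - y) = star x - star y.
Proof. by rewrite starD starN. Qed.

Lemma star1 : star 1 = 1 :> A.
Proof. by have := starM 1 (star (1 : A)); rewrite mul1r starK mul1r. Qed.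

Lemma sqr_rnorm x : rnorm (star x * x) = rnorm x ^+ 2.
Proof. by apply: complexI; rewrite rmorphXn/= -!anormE cstar_identity. Qed.

Lemma rnorm_star x : rnorm (star x) = rnorm x.
Proof.
suff le y : rnorm y <= rnorm (star y).
  by apply/eqP; rewrite eq_le le andbT -{2}(starK x) le.
have [->|y0] := eqVneq (rnorm y) 0; first exact: rnorm_ge0.
have yp : 0 < rnorm y by rewrite lt_def y0 rnorm_ge0.
by rewrite -(@ler_pM2r _ (rnorm y))// -expr2 -sqr_rnorm rnormM.
Qed.

Lemma rnorm1 : rnorm (1 : A) = 1.
Proof.
have n0 : rnorm (1 : A) != 0.
  by apply/eqP => /rnorm0_eq0/eqP; rewrite oner_eq0.
by apply: (mulIf n0); rewrite mul1r -expr2 -sqr_rnorm star1 mulr1.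
Qed.

Lemma rnorm_isometry x : star x * x = 1 -> rnorm x = 1.
Proof.
move=> x1; apply/eqP; rewrite -(@eqrXn2 _ 2)// ?rnorm_ge0//.
by rewrite -sqr_rnorm x1 rnorm1 expr1n.
Qed.

Lemma rnorm_sqB x y : rnorm (x * x - y * y) <= (rnorm x + rnorm y) * rnorm (x - y).
Proof.
have -> : x * x - y * y = x * (x - y) + (x - y) * y.
  by rewrite mulrBr mulrBl addrA subrK.
rewrite (le_trans (rnormD _ _))// [leRHS]mulrDl lerD ?rnormM//.
by rewrite mulrC rnormM.
Qed.

(** A square root without functional calculus: for y = 1 - z the equation
    y^2 = 1 - h becomes z = (h + z^2) / 2, whose right-hand side is a
    contraction with constant [t] of the ball of radius [t]. The iterates that
    start from 0 are selfadjoint, hence so is the fixed point. *)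
Lemma selfadjoint_sqrt h (t : R) : star h = h -> rnorm h <= t -> t < 1 ->
  exists2 y, star y = y & y * y = 1 - h.
Proof.
move=> hs ht t1.
have t0 : 0 <= t by rewrite (le_trans _ ht)// rnorm_ge0.
pose c : R[i] := (2^-1 : R)%:C.
have cr : (c^*)%R = c by exact: conjc_real.
have cn : normc c = 2^-1 by rewrite normc_real ger0_norm.
pose step z := c *: (h + z * z).
pose z n := iter n step 0.
have zt n : rnorm (z n) <= t.
  elim: n => [|n ih]; first by rewrite /z/= rnorm0.
  rewrite [z _]/= /step rnormZ cn.
  have := rnormD h (z n * z n); have := rnormM (z n) (z n).
  have := rnorm_ge0 (z n); nra.
have zs n : star (z n) = z n.
  elim: n => [|n ih]; first exact: star0.
  by rewrite [z _]/= /step starZ starD starM hs -/(z n) ih cr.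
have stepB x y : rnorm (step x - step y) <= 2^-1 * ((rnorm x + rnorm y) * rnorm (x - y)).
  by rewrite /step -scalerBr rnormZ cn ler_pM2l// opprD addrACA subrr add0r rnorm_sqB.
have zC n m : (n <= m)%N -> rnorm (z n - z m) <= t ^+ n.
  elim: n m => [|n ih] m; first by rewrite sub0r rnormN expr0 (le_trans (zt m))// ltW.
  case: m => // m; rewrite ltnS => /ih {}ih.
  rewrite (le_trans (stepB _ _))// exprS.
  have := zt n; have := zt m; have := rnorm_ge0 (z n - z m).
  have := exprn_ge0 n t0; move: ih.
  move: (rnorm _) (t ^+ n) (rnorm (z m)) (rnorm (z n)) => a b d f; nra.
have tcv : (fun n => t ^+ n) @ \oo --> 0 by apply: cvg_expr; rewrite ger0_norm.
have [l lP] := (seq_completeP A).2 (@anorm_complete _ A) z _ tcv zC.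
have ls : star l = l.
  apply/eqP; rewrite -subr_eq0; apply/eqP/rnorm0_eq0/eqP.
  rewrite eq_le rnorm_ge0 andbT; apply: (le0_of_lim (cvgMl0 2 tcv)) => n.
  rewrite (le_trans (rnorm_triangle (z n) _ _))//.
  have -> : rnorm (star l - z n) = rnorm (z n - l).
    by rewrite -[in LHS](zs n) -starB rnorm_star rnorm_distC.
  by have := lP n; lra.
have lE : l = step l.
  apply/eqP; rewrite -subr_eq0; apply/eqP/rnorm0_eq0/eqP.
  rewrite eq_le rnorm_ge0 andbT.
  apply: (le0_of_lim (cvgMl0 (1 + rnorm l + t) tcv)) => n.
  rewrite (le_trans (rnorm_triangle (z n.+1) _ _))// rnorm_distC.
  have := stepB (z n) l; rewrite -[step (z n)]/(z n.+1).
  have := lP n.+1; have := lP n; have := zt n; have := rnorm_ge0 l.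
  have := rnorm_ge0 (z n); have := exprn_ge0 n t0; rewrite exprS.
  have := rnorm_ge0 (z n - l).
  move: (t ^+ n) (rnorm (z n)) (rnorm l) (rnorm (z n - l)) => a b d f.
  move: (rnorm _) (rnorm _) => g k *; nra.
exists (1 - l); first by rewrite starB star1 ls.
have dl : h + l * l = l + l.
  rewrite {3 4}lE -scalerDl -rmorphD/= (_ : 2^-1 + 2^-1 = 1); last by lra.
  by rewrite scale1r.
have -> : h = l + l - l * l by rewrite -dl addrK.
by rewrite mulrBr mulr1 mulrBl mul1r -addrA -opprD addrA.
Qed.

End CstarTheory.

Section Commutant.
Variables (R : realType) (A : cstarAlgType R[i]).
Implicit Types (S : set A) (x y : A).

Definition commutant S : set A := [set x | forall y, S y -> x * y = y * x].

(** Stability under the involution is where the set has to be selfadjoint;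
    closedness follows from the continuity of the product. *)
Lemma commutant_cstar S : (forall x, S x -> S (star x)) ->
  cstar_subalgebra (commutant S).
Proof.
move=> Ss; split.
- by move=> y _; rewrite mulr0 mul0r.
- by move=> x y xS yS z Sz; rewrite mulrDl mulrDr xS ?yS.
- by move=> a x xS z Sz; rewrite -scalerAl -scalerAr xS.
- by move=> x y xS yS z Sz; rewrite -mulrA yS// mulrA xS// mulrA.
- move=> x xS z Sz; rewrite -[z in LHS]starK -[z in RHS]starK -!starM.
  by rewrite xS//; exact: Ss.
- apply/closed_approx => x xS z Sz.
  apply/eqP; rewrite -subr_eq0; apply/eqP/rnorm0_eq0/eqP.
  rewrite eq_le rnorm_ge0 andbT; apply: le0_of_eps => e e0.
  have mp : 0 < 2 * rnorm z + 1 by rewrite ltr_wpDl// mulr_ge0 ?rnorm_ge0.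
  have [|y yS xy] := xS (e / (2 * rnorm z + 1)); first by rewrite divr_gt0.
  have -> : x * z - z * x = (x - y) * z - z * (x - y).
    by rewrite mulrBl mulrBr (yS z Sz) opprB addrA subrK.
  rewrite (le_trans (rnormD _ _))// rnormN.
  have := rnormM (x - y) z; have := rnormM z (x - y).
  move: xy; rewrite ltr_pdivlMr//; have := rnorm_ge0 (x - y); have := rnorm_ge0 z.
  nra.
Qed.

(** The double commutant of [D] and [w] is a commutative C*-algebra that
    contains both, so by maximality it is [D] itself. Its commutativity is
    formal: a commutative set lies in its commutant, which therefore contains
    the double commutant and commutes with it. *)
Lemma maximal_abelian_commutant (D : set A) (w : A) : maximal_abelian D ->
  unitary w -> commutant D w -> D w.
Proof.
move=> [[D0 DD DZ DM Ds Dc] Dab Dmax] [ww' w'w] wD.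
pose S := D `|` [set w; star w].
have starS x : S x -> S (star x).
  move=> [Dx|[->|->]]; first by left; exact: Ds.
    by right; right.
  by right; left; rewrite starK.
have w'D x : D x -> star w * x = x * star w.
  move=> Dx; rewrite -[LHS]mulr1 -w'w mulrA -(mulrA (star w)) -(wD x Dx).
  by rewrite mulrA ww' mul1r.
have Sab x y : S x -> S y -> x * y = y * x.
  move=> [Dx|[->|->]] [Dy|[->|->]] //.
  - exact: Dab.
  - by rewrite wD.
  - by rewrite w'D.
  - exact: wD.
  - by rewrite w'w.
  - exact: w'D.
  - by rewrite w'w.
(* The commutant of [S] is again selfadjoint. *)
have cs : forall x, commutant S x -> commutant S (star x).
  exact: (csub_star (commutant_cstar starS)).
have SE : S `<=` commutant (commutant S).
  by move=> x Sx y Cy; rewrite Cy.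
rewrite -(Dmax (commutant (commutant S))).
- by apply: SE; right; left.
- exact: commutant_cstar.
- move=> x y Ex Ey; apply: Ex => z Sz; apply: Ey => t St; exact: Sab.
- by move=> x Dx; apply: SE; left.
Qed.

End Commutant.

(** * Hilbert spaces *)

(** Hilbert spaces are taken to be nonzero because their operator algebras
    must satisfy [1 != 0]. Completeness is stated for sequences with a known
    rate of convergence [e], so that limits come with an error estimate. *)
HB.mixin Record Lmodule_isHilbert (R : realType) H & GRing.Lmodule R[i] H := {
  dot : H -> H -> R[i];
  dotDl : forall x y z, dot (x + y) z = dot x z + dot y z;
  dotZl : forall a x z, dot (a *: x) z = a * dot x z;
  dotC : forall x y, dot y x = (dot x y)^*%R;
  dot_ge0 : forall x, 0 <= Re (dot x x);
  dot_eq0 : forall x, Re (dot x x) = 0 -> x = 0;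
  hilbert_nonzero : exists x : H, x <> 0;
  hilbert_complete : forall (x : nat -> H) (e : nat -> R),
    e @ \oo --> 0 ->
    (forall n m, (n <= m)%N -> Num.sqrt (Re (dot (x n - x m) (x n - x m))) <= e n) ->
    exists l, forall n, Num.sqrt (Re (dot (x n - l) (x n - l))) <= e n
}.

#[short(type="hilbertType")]
HB.structure Definition Hilbert (R : realType) :=
  {H of Lmodule_isHilbert R H & GRing.Lmodule R[i] H}.

Section HilbertTheory.
Variables (R : realType) (H : hilbertType R).
Implicit Types x y z : H.

Definition hnorm x : R := Num.sqrt (Re (dot x x)).

Lemma dotDr x y z : dot x (y + z) = dot x y + dot x z.
Proof. by rewrite dotC dotDl rmorphD/= -!dotC. Qed.

Lemma dotZr (a : R[i]) x z : dot x (a *: z) = (a^*)%R * dot x z.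
Proof. by rewrite dotC dotZl rmorphM/= -!dotC. Qed.

Lemma dotNl x z : dot (- x) z = - dot x z.
Proof. by rewrite -scaleN1r dotZl mulN1r. Qed.

Lemma dotNr x z : dot x (- z) = - dot x z.
Proof. by rewrite dotC dotNl rmorphN/= -dotC. Qed.

Lemma dot0l z : dot 0 z = 0.
Proof. by rewrite -(scale0r 0) dotZl mul0r. Qed.

Lemma hnorm_ge0 x : 0 <= hnorm x. Proof. exact: sqrtr_ge0. Qed.

Lemma sqr_hnorm x : hnorm x ^+ 2 = Re (dot x x).
Proof. by rewrite sqr_sqrtr// dot_ge0. Qed.

Lemma hnorm0 : hnorm 0 = 0 :> R.
Proof. by rewrite /hnorm dot0l sqrtr0. Qed.

Lemma hnorm_eq0 x : hnorm x = 0 -> x = 0.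
Proof. by move=> x0; apply: dot_eq0; rewrite -sqr_hnorm x0 expr0n. Qed.

Lemma dotxx_real x : dot x x = (Re (dot x x))%:C.
Proof.
have := dotC x x; rewrite -[X in _ = X]/(conjc _).
case: (dot x x) => a b [/eqP]; rewrite -addr_eq0 -mulr2n mulrn_eq0/=.
by move=> /eqP ->.
Qed.

Lemma hnormZ (a : R[i]) x : hnorm (a *: x) = normc a * hnorm x.
Proof.
rewrite /hnorm dotZl dotZr dotxx_real mulrA -/(normc a).
have -> : a * (a^*)%R = (normc a ^+ 2)%:C.
  by rewrite -normCK normCE rmorphXn.
by rewrite -rmorphM/= sqrtrM ?sqr_ge0// sqrtr_sqr ger0_norm// normc_ge0.
Qed.

Lemma hnormN x : hnorm (- x) = hnorm x.
Proof. by rewrite /hnorm dotNl dotNr opprK. Qed.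

Lemma hnorm_distC x y : hnorm (x - y) = hnorm (y - x).
Proof. by rewrite -hnormN opprB. Qed.

Lemma sqr_hnormD x y :
  hnorm (x + y) ^+ 2 = hnorm x ^+ 2 + hnorm y ^+ 2 + 2 * Re (dot x y).
Proof.
rewrite !sqr_hnorm dotDl !dotDr (dotC x y).
rewrite -[X in _ = _ + _ * X]/(Re (dot x y)) -[X in _ + (X + _)]/(conjc (dot x y)).
move: (dot x x) (dot y y) (dot x y) => [a b] [c d] [e f] /=; ring.
Qed.

(** Cauchy-Schwarz for the real part: the vector |y| x - |x| y has a
    nonnegative squared norm. *)
Lemma Re_dot_le x y : Re (dot x y) <= hnorm x * hnorm y.
Proof.
have [x0|x0] := eqVneq (hnorm x) 0.
  by rewrite (hnorm_eq0 x0) dot0l hnorm0 mul0r.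
have [y0|y0] := eqVneq (hnorm y) 0.
  by rewrite (hnorm_eq0 y0) dotC dot0l hnorm0 mulr0 rmorph0.
have xp : 0 < hnorm x by rewrite lt_def x0 hnorm_ge0.
have yp : 0 < hnorm y by rewrite lt_def y0 hnorm_ge0.
have := sqr_ge0 (hnorm ((hnorm y)%:C *: x + (- (hnorm x)%:C) *: y)).
rewrite sqr_hnormD !hnormZ dotZl dotZr -(rmorphN (real_complex R)).
rewrite !normc_real normrN !ger0_norm ?hnorm_ge0//.
rewrite [((- hnorm x)%:C^*)%R]conjc_real mulrA -rmorphM/=.
set d := dot x y; have -> : Re ((hnorm y * - hnorm x)%:C * d) = (hnorm y * - hnorm x) * Re d.
  by case: d => a b /=; ring.
move=> h; rewrite -(@ler_pM2l _ (hnorm x * hnorm y)) ?mulr_gt0//.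
nra.
Qed.

Lemma hnormD x y : hnorm (x + y) <= hnorm x + hnorm y.
Proof.
rewrite -(@ler_pXn2r _ 2)// ?nnegrE ?addr_ge0 ?hnorm_ge0//.
by rewrite sqr_hnormD; have := Re_dot_le x y; nra.
Qed.

Lemma dot_inj x y : (forall z, dot x z = dot y z) -> x = y.
Proof.
move=> e; apply/eqP; rewrite -subr_eq0; apply/eqP/dot_eq0.
by rewrite dotDl dotNl e subrr.
Qed.

(** Multiplication of [x] by the conjugate of the inner product turns the
    inner product into its squared modulus, a real number. *)
Lemma normc_dot_le x y : normc (dot x y) <= hnorm x * hnorm y.
Proof.
set d := dot x y.
have [d0|d0] := eqVneq (normc d) 0.
  by rewrite d0 mulr_ge0 ?hnorm_ge0.
have dp : 0 < normc d by rewrite lt_def d0 normc_ge0.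
have := Re_dot_le ((d^*)%R *: x) y.
rewrite dotZl mulrC -/d hnormZ normc_conj -mulrA.
have -> : d * (d^*)%R = (normc d ^+ 2)%:C by rewrite -normCK normCE rmorphXn.
by rewrite [Re _]/= expr2 ler_pM2l.
Qed.

End HilbertTheory.

(** * The C*-algebra of bounded operators on a Hilbert space *)

Section BoundedOperators.
Variables (R : realType) (H : hilbertType R).
Implicit Types x y z : H.

(** An operator is encoded together with its adjoint. The involution is then
    the exchange of the two components, linearity is a consequence of the
    adjoint relation, and limits of operators are taken in both components at
    once. *)
Definition adjoint_pairs : set ((H -> H) * (H -> H)) :=
  [set ST | (forall x y, dot (ST.1 x) y = dot x (ST.2 y)) /\
            exists M : R, forall x, hnorm (ST.1 x) <= M * hnorm x].

Definition bop : Type := set_type adjoint_pairs.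

HB.instance Definition _ := Choice.on bop.

Definition bfun (S : bop) : H -> H := (val S).1.
Definition badj (S : bop) : H -> H := (val S).2.
Coercion bfun : bop >-> Funclass.

Implicit Types S T U : bop.

Lemma adjP S x y : dot (S x) y = dot x (badj S y).
Proof. exact: (set_mem (valP S)).1. Qed.

Lemma adjPr S x y : dot x (S y) = dot (badj S x) y.
Proof. by rewrite dotC adjP -dotC. Qed.

Lemma bop_bounded S : exists M : R, forall x, hnorm (S x) <= M * hnorm x.
Proof. exact: (set_mem (valP S)).2. Qed.

Lemma badj_unique S (f : H -> H) :
  (forall x y, dot (S x) y = dot x (f y)) -> badj S = f.
Proof.
move=> fP; apply/funext => y; apply: dot_inj => z.
by rewrite dotC -adjP fP -dotC.
Qed.

Lemma bopP S T : (forall x, S x = T x) -> S = T.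
Proof.
move=> /funext e; apply: val_inj; move: e; rewrite /bfun => e.
have ea : badj S = badj T.
  by apply: badj_unique => x y; rewrite /bfun e; exact: adjP.
by rewrite (surjective_pairing (val S)) [RHS]surjective_pairing; congr pair.
Qed.

Lemma bopD S x y : S (x + y) = S x + S y.
Proof. by apply: dot_inj => z; rewrite adjP !dotDl !adjP. Qed.

Lemma bopZ S a x : S (a *: x) = a *: S x.
Proof. by apply: dot_inj => z; rewrite adjP !dotZl !adjP. Qed.

Lemma bop0 S : S 0 = 0.
Proof. by have := bopZ S 0 0; rewrite !scale0r. Qed.

Lemma adj_pos_bound S : exists2 M : R, 0 <= M &
  forall x, hnorm (S x) <= M * hnorm x.
Proof.
have [M MP] := bop_bounded S; exists `|M| => // x.
by rewrite (le_trans (MP x))// ler_wpM2r ?hnorm_ge0// ler_norm.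
Qed.

(** The squared norm of [g y] is the inner product of [f (g y)] with [y]. *)
Lemma adj_bounded (f g : H -> H) (M : R) : 0 <= M ->
  (forall x y, dot (f x) y = dot x (g y)) ->
  (forall x, hnorm (f x) <= M * hnorm x) ->
  forall y, hnorm (g y) <= M * hnorm y.
Proof.
move=> M0 adj fM y.
have [->|g0] := eqVneq (hnorm (g y)) 0; first by rewrite mulr_ge0 ?hnorm_ge0.
have gp : 0 < hnorm (g y) by rewrite lt_def g0 hnorm_ge0.
rewrite -(@ler_pM2l _ (hnorm (g y)))// -expr2 sqr_hnorm -adj.
by rewrite (le_trans (Re_dot_le _ _))// mulrCA mulrA ler_wpM2r ?hnorm_ge0.
Qed.

Definition mk_bop (f g : H -> H) (adj : forall x y, dot (f x) y = dot x (g y))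
    (bd : exists M : R, forall x, hnorm (f x) <= M * hnorm x) : bop :=
  SigSub (mem_set (conj adj bd : adjoint_pairs (f, g))).

Definition bop_zero : bop.
Proof.
apply: (@mk_bop (fun=> 0) (fun=> 0)) => [x y|].
  by rewrite dot0l dotC dot0l rmorph0.
by exists 0 => x; rewrite hnorm0 mul0r.
Defined.

Definition bop_opp S : bop.
Proof.
apply: (@mk_bop (fun x => - S x) (fun x => - badj S x)) => [x y|].
  by rewrite dotNl adjP dotNr.
by have [M MP] := bop_bounded S; exists M => x /=; rewrite hnormN.
Defined.

Definition bop_add S T : bop.
Proof.
apply: (@mk_bop (fun x => S x + T x) (fun x => badj S x + badj T x)) => [x y|] /=.
  by rewrite dotDl !adjP dotDr.
have [M MP] := bop_bounded S; have [N NP] := bop_bounded T; exists (M + N) => x /=.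
by rewrite (le_trans (hnormD _ _))// mulrDl lerD.
Defined.

Definition bop_one : bop.
Proof.
by apply: (@mk_bop id id) => //; exists 1 => x; rewrite mul1r.
Defined.

Definition bop_mul S T : bop.
Proof.
apply: (@mk_bop (S \o T) (badj T \o badj S)) => [x y|] /=.
  by rewrite !adjP.
have [M M0 MP] := adj_pos_bound S; have [N NP] := bop_bounded T.
exists (M * N) => x /=.
by rewrite (le_trans (MP _))// -mulrA ler_wpM2l.
Defined.

Definition bop_scale (a : R[i]) S : bop.
Proof.
apply: (@mk_bop (fun x => a *: S x) (fun x => (a^*)%R *: badj S x)) => [x y|] /=.
  by rewrite dotZl adjP dotZr conjCK.
have [M MP] := bop_bounded S; exists (normc a * M) => x /=.
by rewrite hnormZ -mulrA ler_wpM2l ?normc_ge0.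
Defined.

Definition bop_star S : bop.
Proof.
apply: (@mk_bop (badj S) S) => [x y|].
  by rewrite -adjPr.
have [M M0 MP] := adj_pos_bound S; exists M.
by apply: adj_bounded MP => // x y; exact: adjP.
Defined.

Fact bop_addA : associative bop_add.
Proof. by move=> S T U; apply: bopP => x; exact: addrA. Qed.
Fact bop_addC : commutative bop_add.
Proof. by move=> S T; apply: bopP => x; exact: addrC. Qed.
Fact bop_add0 : left_id bop_zero bop_add.
Proof. by move=> S; apply: bopP => x; exact: add0r. Qed.
Fact bop_addN : left_inverse bop_zero bop_opp bop_add.
Proof. by move=> S; apply: bopP => x; exact: addNr. Qed.

HB.instance Definition _ :=
  GRing.isZmodule.Build bop bop_addA bop_addC bop_add0 bop_addN.

Fact bop_mulA : associative bop_mul.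
Proof. by move=> S T U; apply: bopP. Qed.
Fact bop_mul1 : left_id bop_one bop_mul.
Proof. by move=> S; apply: bopP. Qed.
Fact bop_mulr1 : right_id bop_one bop_mul.
Proof. by move=> S; apply: bopP. Qed.
Fact bop_mulDl : left_distributive bop_mul +%R.
Proof. by move=> S T U; apply: bopP. Qed.
Fact bop_mulDr : right_distributive bop_mul +%R.
Proof. by move=> S T U; apply: bopP => x; exact: bopD. Qed.
Fact bop_one_neq0 : bop_one != 0.
Proof.
apply/eqP => e; have [x] := hilbert_nonzero (s := H); apply.
by rewrite -[LHS]/(bop_one x) e.
Qed.

HB.instance Definition _ := GRing.Zmodule_isNzRing.Build bop
  bop_mulA bop_mul1 bop_mulr1 bop_mulDl bop_mulDr bop_one_neq0.

Fact bop_scaleA (a b : R[i]) S : bop_scale a (bop_scale b S) = bop_scale (a * b) S.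
Proof. by apply: bopP => x; exact: scalerA. Qed.
Fact bop_scale1 : left_id 1 bop_scale.
Proof. by move=> S; apply: bopP => x; exact: scale1r. Qed.
Fact bop_scaleDr : right_distributive bop_scale +%R.
Proof. by move=> a S T; apply: bopP => x; exact: scalerDr. Qed.
Fact bop_scaleDl S : {morph bop_scale^~ S : a b / a + b}.
Proof. by move=> a b; apply: bopP => x; exact: scalerDl. Qed.

HB.instance Definition _ := GRing.Zmodule_isLmodule.Build R[i] bop
  bop_scaleA bop_scale1 bop_scaleDr bop_scaleDl.

Fact bop_scaleAl (a : R[i]) S T : a *: (S * T) = (a *: S) * T.
Proof. by apply: bopP. Qed.
HB.instance Definition _ := GRing.Lmodule_isLalgebra.Build R[i] bop bop_scaleAl.
Fact bop_scaleAr (a : R[i]) S T : a *: (S * T) = S * (a *: T).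
Proof. by apply: bopP => x; rewrite -[RHS]/(S (a *: T x)) bopZ. Qed.
HB.instance Definition _ := GRing.Lalgebra_isAlgebra.Build R[i] bop bop_scaleAr.

Lemma bop_addE S T x : bfun (S + T) x = S x + T x. Proof. by []. Qed.
Lemma bop_oppE S x : bfun (- S) x = - S x. Proof. by []. Qed.
Lemma bop_mulE S T x : bfun (S * T) x = S (T x). Proof. by []. Qed.
Lemma bop_oneE x : bfun 1 x = x. Proof. by []. Qed.
Lemma bop_zeroE x : bfun 0 x = 0. Proof. by []. Qed.
Lemma bop_scaleE a S x : bfun (a *: S) x = a *: S x. Proof. by []. Qed.
Lemma bop_sumE I (r : seq I) (P : pred I) (F : I -> bop) x :
  bfun (\sum_(i <- r | P i) F i) x = \sum_(i <- r | P i) F i x.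
Proof. by elim/big_rec2: _ => // i y1 y2 _ <-. Qed.

Definition opnorm S : R :=
  inf [set M | 0 <= M /\ forall x, hnorm (S x) <= M * hnorm x].

Lemma opnorm_inf S :
  has_inf [set M | 0 <= M /\ forall x, hnorm (S x) <= M * hnorm x].
Proof.
split; first by have [M ? ?] := adj_pos_bound S; exists M.
by exists 0 => M [].
Qed.

Lemma opnorm_ge0 S : 0 <= opnorm S.
Proof. by apply: lb_le_inf; [case: (opnorm_inf S)|move=> M []]. Qed.

Lemma opnorm_le S (M : R) : 0 <= M -> (forall x, hnorm (S x) <= M * hnorm x) ->
  opnorm S <= M.
Proof. by move=> M0 MP; apply: ge_inf; [case: (opnorm_inf S)|]. Qed.

Lemma le_opnorm S x : hnorm (S x) <= opnorm S * hnorm x.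
Proof.
have [x0|x0] := eqVneq (hnorm x) 0.
  by rewrite (hnorm_eq0 x0) bop0 !hnorm0 mulr0.
have xp : 0 < hnorm x by rewrite lt_def x0 hnorm_ge0.
rewrite -ler_pdivrMr//; apply: lb_le_inf; first by case: (opnorm_inf S).
by move=> M [_ MP]; rewrite ler_pdivrMr.
Qed.

Fact opnormD S T : (opnorm (S + T))%:C <= (opnorm S)%:C + (opnorm T)%:C.
Proof.
rewrite -rmorphD lecR; apply: opnorm_le; first by rewrite addr_ge0 ?opnorm_ge0.
move=> x; rewrite bop_addE (le_trans (hnormD _ _))// mulrDl.
by rewrite lerD ?le_opnorm.
Qed.

Lemma opnormZ_le (a : R[i]) S : opnorm (a *: S) <= normc a * opnorm S.
Proof.
apply: opnorm_le; first by rewrite mulr_ge0 ?normc_ge0 ?opnorm_ge0.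
by move=> x; rewrite bop_scaleE hnormZ -mulrA ler_wpM2l ?normc_ge0 ?le_opnorm.
Qed.

Fact opnormZ (a : R[i]) S : (opnorm (a *: S))%:C = `|a| * (opnorm S)%:C.
Proof.
rewrite normCE -rmorphM; congr (_%:C)%C; apply/eqP.
rewrite eq_le opnormZ_le/=.
have [->|a0] := eqVneq a 0; first by rewrite normc0 mul0r opnorm_ge0.
have na0 : 0 < normc a.
  rewrite lt_def normc_ge0 andbT; apply: contra a0 => /eqP/eq0_normc ->.
  exact: eqxx.
rewrite -ler_pdivlMl// -normcV.
by rewrite -{1}(scalerK a0 S) opnormZ_le.
Qed.

Fact opnorm0_eq0 S : (opnorm S)%:C = 0 -> S = 0.
Proof.
move=> [S0]; apply: bopP => x; apply: hnorm_eq0; apply/eqP.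
by rewrite eq_le hnorm_ge0 andbT (le_trans (le_opnorm _ _))// S0 mul0r.
Qed.

Fact opnormM S T : (opnorm (S * T))%:C <= (opnorm S)%:C * (opnorm T)%:C.
Proof.
rewrite -rmorphM lecR; apply: opnorm_le; first by rewrite mulr_ge0 ?opnorm_ge0.
move=> x; rewrite bop_mulE (le_trans (le_opnorm _ _))// -mulrA.
by rewrite ler_wpM2l ?opnorm_ge0 ?le_opnorm.
Qed.

HB.instance Definition _ :=
  isNormedAlgebra.Build R[i] bop opnormD opnormZ opnorm0_eq0 opnormM.

End BoundedOperators.

Section BopComplete.
Variables (R : realType) (H : hilbertType R).
Implicit Types S T U : bop H.

Lemma rnorm_bop S : rnorm S = opnorm S. Proof. by []. Qed.

Fact bop_starK : involutive (@bop_star R H).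
Proof. by move=> S; apply: bopP. Qed.
Fact bop_starD : {morph @bop_star R H : S T / S + T}.
Proof. by move=> S T; apply: bopP. Qed.
Fact bop_starZ (a : R[i]) S : bop_star (a *: S) = (a^*)%R *: bop_star S.
Proof. by apply: bopP. Qed.
Fact bop_starM S T : bop_star (S * T) = bop_star T * bop_star S.
Proof. by apply: bopP. Qed.

Lemma opnorm_star S : opnorm (bop_star S) = opnorm S.
Proof.
suff le T : opnorm (bop_star T) <= opnorm T.
  by apply/eqP; rewrite eq_le le/= -{1}(bop_starK S) le.
apply: opnorm_le; first exact: opnorm_ge0.
apply: (@adj_bounded _ _ T) (opnorm_ge0 _) _ _ => x; last exact: le_opnorm.
exact: adjP.
Qed.

(** The squared norm of [S x] is the inner product of [star S * S] applied to
    [x] with [x]. *)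
Fact bop_cstar S : anorm (bop_star S * S) = anorm S ^+ 2.
Proof.
rewrite !anormE -rmorphXn/=; congr (_%:C)%C; apply/eqP; rewrite eq_le.
apply/andP; split.
  by rewrite (le_trans (rnormM _ _))// !rnorm_bop opnorm_star expr2.
rewrite -[leRHS]sqr_sqrtr ?rnorm_ge0// lerXn2r ?nnegrE ?rnorm_ge0 ?sqrtr_ge0//.
apply: opnorm_le; first exact: sqrtr_ge0.
move=> x; rewrite -(@ler_pXn2r _ 2)// ?nnegrE ?hnorm_ge0//; last first.
  by rewrite mulr_ge0 ?hnorm_ge0 ?sqrtr_ge0.
rewrite exprMn (sqr_hnorm (S x)) [X in _ <= X * _]sqr_sqrtr ?rnorm_ge0//.
rewrite adjP dotC -[X in Re X]/(conjc _).
rewrite [leLHS](_ : _ = Re (dot (badj S (S x)) x)); last by case: (dot _ _).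
rewrite -[leLHS]/(Re (dot (bfun (bop_star S * S) x) x)).
rewrite (le_trans (Re_dot_le _ _))// [X in _ <= _ * X]expr2 mulrA.
by rewrite ler_wpM2r ?hnorm_ge0 ?le_opnorm.
Qed.

(** The limit is pointwise, for the operators and for their adjoints; the
    adjoint relation survives because both sides are within
    2 e(n) |x| |y| of each other for every [n]. *)
Lemma bop_complete (S : nat -> bop H) (e : nat -> R) : e @ \oo --> 0 ->
  (forall n m, (n <= m)%N -> rnorm (S n - S m) <= e n) ->
  exists L, forall n, rnorm (S n - L) <= e n.
Proof.
move=> e0 Se.
have en n : 0 <= e n by rewrite (le_trans _ (Se n n (leqnn n)))// rnorm_ge0.
have lim (T : nat -> bop H) :
    (forall n m, (n <= m)%N -> rnorm (T n - T m) <= e n) ->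
    exists f, forall x n, hnorm (T n x - f x) <= e n * hnorm x.
  move=> Te.
  suff /choice[f fP] x : exists y, forall n, hnorm (T n x - y) <= e n * hnorm x.
    by exists f.
  apply: (hilbert_complete (fun n => T n x) (fun n => e n * hnorm x)).
    by rewrite -[X in _ --> X](mul0r (hnorm x)); apply: cvgM => //; exact: cvg_cst.
  move=> n m nm; rewrite -/(hnorm _) -[_ - _]/(bfun (T n - T m) x).
  by rewrite (le_trans (le_opnorm _ _))// ler_wpM2r ?hnorm_ge0 ?Te.
have [f fP] := lim S Se.
have [|g gP] := lim (fun n => bop_star (S n)).
  move=> n m nm; rewrite (_ : _ - _ = bop_star (S n - S m)).
    by rewrite rnorm_bop opnorm_star Se.
  by apply: bopP.
have adj x y : dot (f x) y = dot x (g y).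
  apply/eqP; rewrite -subr_eq0; apply/eqP/eq0_normc/eqP.
  rewrite eq_le normc_ge0 andbT; apply: le0_of_eps => d d0.
  (* The summand 1 keeps [M] positive when [x] or [y] vanishes. *)
  pose M := 2 * (hnorm x * hnorm y) + 1.
  have M0 : 0 < M by rewrite ltr_wpDl// !mulr_ge0 ?hnorm_ge0.
  have dM : 0 < d / M by rewrite divr_gt0.
  have /cvgrPdist_lt/(_ _ dM)[n _ /(_ n (leqnn _))] := e0.
  rewrite sub0r normrN ger0_norm// ltr_pdivlMr// => ed.
  have -> : dot (f x) y - dot x (g y) =
      dot x (bop_star (S n) y - g y) - dot (S n x - f x) y.
    rewrite dotDr dotNr dotDl dotNl -[bfun (bop_star _) y]/(badj (S n) y) -adjP.
    ring.
  rewrite (le_trans (le_normcD _ _))// normcN.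
  have := normc_dot_le x (bop_star (S n) y - g y).
  have := normc_dot_le (S n x - f x) y.
  have := fP x n; have := gP y n; move: ed; rewrite /M.
  have := hnorm_ge0 x; have := hnorm_ge0 y; have := en n.
  have := hnorm_ge0 (S n x - f x); have := hnorm_ge0 (bop_star (S n) y - g y).
  nra.
have bd : exists M : R, forall x, hnorm (f x) <= M * hnorm x.
  exists (opnorm (S 0%N) + e 0%N) => x.
  rewrite mulrDl -[f x](subrK (S 0%N x)) addrC (le_trans (hnormD _ _))//.
  by rewrite lerD ?le_opnorm// hnorm_distC.
exists (mk_bop adj bd) => n; apply: opnorm_le => // x; exact: fP.
Qed.

Fact bop_anorm_complete (F : set_system (normed_space (bop H))) :
  ProperFilter F -> cauchy F -> cvg F.
Proof. exact: (seq_completeP (bop H)).1 (@bop_complete) F. Qed.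

HB.instance Definition _ := NormedAlgebra_isCstar.Build R[i] (bop H)
  bop_anorm_complete bop_starK bop_starD bop_starZ bop_starM bop_cstar.

End BopComplete.

(** * Star morphisms into bounded operators are contractive *)

Section Contractive.
Variables (R : realType) (A : cstarAlgType R[i]) (H : hilbertType R).
Variable phi : {lrmorphism A -> bop H}.
Hypothesis phi_star : star_morphism phi.

(** If |x| < 1 then 1 - star x x = z^2 with [z] selfadjoint, so that
    |phi(x) v|^2 + |phi(z) v|^2 = |v|^2. The existence of [z] uses the
    completeness of [A]; the general case follows by rescaling [x]. *)
Lemma star_morphism_contractive x (v : H) :
  hnorm (bfun (phi x) v) <= rnorm x * hnorm v.
Proof.
have unit_ball y : rnorm y < 1 -> hnorm (bfun (phi y) v) <= hnorm v.
  move=> y1.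
  have [||z zs zz] := @selfadjoint_sqrt _ _ (star y * y) (rnorm (star y * y)) _ (lexx _).
    by rewrite starM starK.
    by rewrite sqr_rnorm expr_lt1// rnorm_ge0.
  rewrite -(@ler_pXn2r _ 2)// ?nnegrE ?hnorm_ge0// !sqr_hnorm.
  have sqE w : dot (bfun (phi w) v) (bfun (phi w) v) = dot v (bfun (phi (star w * w)) v).
    by rewrite adjP rmorphM/= phi_star.
  have := dot_ge0 (bfun (phi z) v); rewrite !sqE zs zz rmorphB rmorph1.
  by rewrite bop_addE bop_oneE bop_oppE dotDr dotNr [Re _]raddfB subr_ge0.
rewrite -subr_le0; apply: le0_of_eps => e e0.
have hp : 0 < hnorm v + 1 by rewrite ltr_wpDl ?hnorm_ge0.
pose d := e / (hnorm v + 1); have d0 : 0 < d by rewrite divr_gt0.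
have dE : d * (hnorm v + 1) = e by rewrite divfK// gt_eqF.
have rp : 0 < rnorm x + d by rewrite ltr_wpDl ?rnorm_ge0.
have ri : 0 <= (rnorm x + d)^-1 by rewrite invr_ge0 ltW.
have := unit_ball ((rnorm x + d)^-1%:C *: x).
rewrite rnormZ normc_real ger0_norm// mulrC ltr_pdivrMr// mul1r.
rewrite ltrDl => /(_ d0).
rewrite linearZ bop_scaleE hnormZ normc_real ger0_norm//.
rewrite ler_pdivrMl//; lra.
Qed.

End Contractive.

(** * Unordered sums of real and complex families *)

Section RealSums.
Variables (R : realType) (I : choiceType).
Implicit Types f g a b : I -> R.

(** [fine] sends an infinite sum to 0, so the value is meaningful for
    summable families only. *)
Definition nsum f : R := fine (\esum_(i in [set: I]) (f i)%:E).

Definition nsummable f : Prop :=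
  (forall i, 0 <= f i) /\ (\esum_(i in [set: I]) (f i)%:E < +oo)%E.

Lemma nsumE f : nsummable f -> (\esum_(i in [set: I]) (f i)%:E)%E = (nsum f)%:E.
Proof.
move=> [f0 fs]; rewrite fineK// ge0_fin_numE//.
by apply: esum_ge0 => i _; rewrite lee_fin.
Qed.

Lemma nsum_ge0 f : nsummable f -> 0 <= nsum f.
Proof.
move=> [f0 _]; apply: fine_ge0.
by apply: esum_ge0 => i _; rewrite lee_fin.
Qed.

Lemma nsummable_ge0 f i : nsummable f -> 0 <= f i. Proof. by case. Qed.

Lemma nsummable_le f g : (forall i, 0 <= f i <= g i) -> nsummable g -> nsummable f.
Proof.
move=> fg [_ gs]; split=> [i|]; first by have /andP[] := fg i.
by apply: le_lt_trans gs; apply: le_esum => i _; rewrite lee_fin; have /andP[] := fg i.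
Qed.

Lemma nsummableD f g : nsummable f -> nsummable g -> nsummable (fun i => f i + g i).
Proof.
move=> fs gs; split=> [i|]; first by rewrite addr_ge0 ?nsummable_ge0.
under eq_esum do rewrite EFinD.
rewrite esumD; [|by move=> i _; rewrite lee_fin nsummable_ge0..].
by rewrite !nsumE// -EFinD ltry.
Qed.

Lemma nsumD f g : nsummable f -> nsummable g ->
  nsum (fun i => f i + g i) = nsum f + nsum g.
Proof.
move=> fs gs; apply: EFin_inj; rewrite -nsumE; last exact: nsummableD.
under eq_esum do rewrite EFinD.
rewrite esumD; [|by move=> i _; rewrite lee_fin nsummable_ge0..].
by rewrite !nsumE.
Qed.

Lemma nsummable_bound f (M : R) : (forall i, 0 <= f i) ->
  (forall A : {fset I}, \sum_(i <- A) f i <= M) -> nsummable f /\ nsum f <= M.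
Proof.
move=> f0 fM.
have le : (\esum_(i in [set: I]) (f i)%:E <= M%:E)%E.
  apply: ge_ereal_sup => _ [X [finX _] <-].
  by rewrite fsumEFin// lee_fin fsbig_finite.
have fs : nsummable f by split=> //; apply: le_lt_trans le (ltry _).
by split=> //; rewrite -lee_fin -nsumE.
Qed.

Lemma le_nsum f (A : {fset I}) : nsummable f -> \sum_(i <- A) f i <= nsum f.
Proof.
move=> fs; rewrite -lee_fin -nsumE//; apply: esum_ge.
exists [set` A]; first by split.
by rewrite fsbig_finite//= set_fsetK -sumEFin.
Qed.

Lemma le_nsum1 f i : nsummable f -> f i <= nsum f.
Proof. by move=> /(le_nsum [fset i]%fset); rewrite big_seq_fset1. Qed.

Lemma nsumZ f (c : R) : 0 <= c -> nsummable f ->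
  nsummable (fun i => c * f i) /\ nsum (fun i => c * f i) = c * nsum f.
Proof.
move=> c0 fs.
have half d g : 0 <= d -> nsummable g ->
    nsummable (fun i => d * g i) /\ nsum (fun i => d * g i) <= d * nsum g.
  move=> d0 gs; apply: nsummable_bound => [i|A].
    exact: mulr_ge0 d0 (nsummable_ge0 i gs).
  by rewrite -mulr_sumr ler_wpM2l ?le_nsum.
have [cs cle] := half c f c0 fs; split=> //; apply/eqP; rewrite eq_le cle/=.
have [c00|cn] := eqVneq c 0; first by rewrite {1}c00 mul0r nsum_ge0.
have cp : 0 < c by rewrite lt_def cn.
have [|_] := half c^-1 _ _ cs; first by rewrite invr_ge0.
under [X in nsum X]funext do rewrite mulrA mulVf// mul1r.
by rewrite ler_pdivlMl.
Qed.


Definition rsum f : R :=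
  nsum (fun i => Num.max (f i) 0) - nsum (fun i => Num.max (- f i) 0).

Definition rsummable f : Prop := nsummable (fun i => `|f i|).

Lemma rsummable_pos f : rsummable f -> nsummable (fun i => Num.max (f i) 0).
Proof.
apply: nsummable_le => i; rewrite le_max lexx orbT/=.
by rewrite ge_max normr_ge0 ler_norm.
Qed.

Lemma rsummable_neg f : rsummable f -> nsummable (fun i => Num.max (- f i) 0).
Proof.
apply: nsummable_le => i; rewrite le_max lexx orbT/=.
by rewrite ge_max normr_ge0 -normrN ler_norm.
Qed.

(** The sum does not depend on the way in which a family is written as a
    difference of nonnegative summable families; this gives additivity. *)
Lemma rsumE a b f : nsummable a -> nsummable b -> (forall i, f i = a i - b i) ->
  rsum f = nsum a - nsum b.
Proof.
move=> sa sb fE.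
have sf : rsummable f.
  apply: nsummable_le (nsummableD sa sb) => i; rewrite normr_ge0/= fE.
  have := nsummable_ge0 i sa; have := nsummable_ge0 i sb => b0 a0.
  by rewrite (le_trans (ler_normB _ _))// !ger0_norm.
apply/eqP; rewrite subr_eq addrAC eq_sym subr_eq; apply/eqP.
rewrite -!nsumD//; [|exact: rsummable_pos|exact: rsummable_neg].
congr nsum; apply/funext => i; rewrite fE.
by case: (leP (a i - b i) 0); case: (leP (- (a i - b i)) 0); lra.
Qed.

Lemma rsum_decomp f : rsummable f -> exists a b,
  [/\ nsummable a, nsummable b & forall i, f i = a i - b i].
Proof.
move=> sf; exists (fun i => Num.max (f i) 0), (fun i => Num.max (- f i) 0).
split; [exact: rsummable_pos|exact: rsummable_neg|move=> i].
by case: (leP (f i) 0); case: (leP (- f i) 0); lra.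
Qed.

Lemma nsummable0 : nsummable (fun=> 0 : R).
Proof.
by have [] := @nsummable_bound (fun=> 0) 0 _ _ => // A; rewrite big1.
Qed.

Lemma rsum0 : rsum (fun=> 0) = 0.
Proof.
by rewrite (rsumE nsummable0 nsummable0) ?subrr// => i; rewrite subr0.
Qed.

Lemma rsum_nsum f : nsummable f -> rsum f = nsum f.
Proof.
move=> fs; rewrite (rsumE fs nsummable0) => [|i]; last by rewrite subr0.
suff -> : nsum (fun=> 0 : R) = 0 by rewrite subr0.
by rewrite /nsum esum1.
Qed.

Lemma rsumD f g : rsummable f -> rsummable g ->
  rsum (fun i => f i + g i) = rsum f + rsum g.
Proof.
move=> /rsum_decomp[a [b [sa sb fE]]] /rsum_decomp[c [d [sc sd gE]]].
rewrite (rsumE sa sb fE) (rsumE sc sd gE).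
rewrite (rsumE (nsummableD sa sc) (nsummableD sb sd)) ?nsumD//; first by ring.
by move=> i; rewrite fE gE; ring.
Qed.

Lemma rsumN f : rsum (fun i => - f i) = - rsum f.
Proof.
by rewrite /rsum opprB; congr (nsum _ - _); under eq_fun do rewrite opprK.
Qed.

Lemma rsumZ (c : R) f : rsummable f -> rsum (fun i => c * f i) = c * rsum f.
Proof.
wlog c0 : c f / 0 <= c.
  move=> h fs; have [/h|/ltW c0] := leP 0 c; first exact.
  rewrite -[c]opprK mulNr -h ?oppr_ge0// -rsumN; congr rsum; apply/funext => i.
  by rewrite mulNr.
move=> /rsum_decomp[a [b [sa sb fE]]].
have [sca ca] := nsumZ c0 sa; have [scb cb] := nsumZ c0 sb.
rewrite (rsumE sca scb) ?ca ?cb => [|i]; first by rewrite (rsumE sa sb fE) mulrBr.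
by rewrite fE mulrBr.
Qed.


End RealSums.

Section ComplexSums.
Variables (R : realType) (I : choiceType).
Implicit Types f g : I -> R[i].

Definition csummable f : Prop := nsummable (fun i => normc (f i)).

Definition csum f : R[i] :=
  (rsum (fun i => Re (f i)) +i* rsum (fun i => Im (f i)))%C.

Lemma csummable_Re f : csummable f -> rsummable (fun i => Re (f i)).
Proof. by apply: nsummable_le => i; rewrite normr_ge0 Re_le_normc. Qed.

Lemma csummable_Im f : csummable f -> rsummable (fun i => Im (f i)).
Proof. by apply: nsummable_le => i; rewrite normr_ge0 Im_le_normc. Qed.

Lemma csumD f g : csummable f -> csummable g ->
  csum (fun i => f i + g i) = csum f + csum g.
Proof.
move=> fs gs; rewrite /csum -[RHS]/(Complex _ _).
rewrite -!rsumD; [|by apply: csummable_Im|by apply: csummable_Im|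
  by apply: csummable_Re|by apply: csummable_Re].
by congr Complex; congr rsum; apply/funext => i; case: (f i) (g i) => [? ?] [].
Qed.

Lemma csumZ (c : R[i]) f : csummable f -> csum (fun i => c * f i) = c * csum f.
Proof.
case: c => a b fs; have fr := csummable_Re fs; have fi := csummable_Im fs.
have sZ d h : rsummable h -> @rsummable R I (fun i => d * h i).
  move=> hs; rewrite /rsummable; under eq_fun do rewrite normrM.
  by have [] := nsumZ (normr_ge0 d) hs.
rewrite /csum -[RHS]/(Complex _ _) -!rsumZ// -rsumN -!rsumD//.
- by congr Complex; congr rsum; apply/funext => i; case: (f i).
- exact: sZ.
- exact: sZ.
- exact: sZ.
- by rewrite /rsummable; under eq_fun do rewrite normrN; exact: sZ.
Qed.

Lemma csum_conj f : csum (fun i => (f i)^*%R) = (csum f)^*%R.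
Proof.
rewrite /csum -[RHS]/(Complex _ _) -rsumN.
by congr Complex; congr rsum; apply/funext => i; case: (f i).
Qed.

Lemma csum_real (h : I -> R) : nsummable h -> csum (fun i => (h i)%:C) = (nsum h)%:C.
Proof.
move=> hs; rewrite /csum (rsum_nsum hs)/=; congr Complex.
exact: rsum0.
Qed.


End ComplexSums.

Section Reindexing.
Variables (R : realType) (I J : choiceType) (t : J -> I).
Hypothesis tinj : injective t.
Implicit Type f : I -> R.

Lemma esum_inj f : (forall i, ~ range t i -> f i = 0) ->
  (\esum_(j in [set: J]) (f (t j))%:E = \esum_(i in [set: I]) (f i)%:E)%E.
Proof.
move=> ft.
rewrite -(esum_image [set: J] t (fun i => (f i)%:E)); last by move=> ? ? _ _ /tinj.
rewrite esum_mkcond; apply: eq_esum => i _.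
by case: ifPn => // /negP; rewrite inE => /ft ->.
Qed.

Lemma nsum_inj f : (forall i, ~ range t i -> f i = 0) -> nsum (f \o t) = nsum f.
Proof. by move=> ft; rewrite /nsum -(esum_inj ft). Qed.

Lemma nsummable_comp f : nsummable f -> nsummable (f \o t).
Proof.
move=> fs; pose g i := if `[< range t i >] then f i else 0.
have gt i : ~ range t i -> g i = 0 by rewrite /g; case: asboolP.
have gs : nsummable g.
  apply: (nsummable_le _ fs) => i; rewrite /g.
  by case: ifP => _; rewrite lexx/= ?(nsummable_ge0 i fs).
have -> : f \o t = g \o t.
  by apply/funext => j; rewrite /g /=; case: asboolP => // -[]; exists j.
split=> [j|]; first exact: (nsummable_ge0 (t j) gs).
by rewrite [X in (X < _)%E](esum_inj gt); case: gs.
Qed.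

Lemma nsummable_inj f : (forall i, 0 <= f i) ->
  (forall i, ~ range t i -> f i = 0) -> nsummable (f \o t) -> nsummable f.
Proof. by move=> f0 ft [_ fs]; split=> //; rewrite -(esum_inj ft). Qed.

Lemma rsum_inj f : (forall i, ~ range t i -> f i = 0) -> rsum (f \o t) = rsum f.
Proof.
move=> ft; rewrite /rsum -[in RHS]nsum_inj; last by move=> i /ft ->; rewrite maxxx.
by rewrite -[X in _ = _ - X]nsum_inj// => i /ft ->; rewrite oppr0 maxxx.
Qed.

Lemma csum_inj (f : I -> R[i]) : (forall i, ~ range t i -> f i = 0) ->
  csum (f \o t) = csum f.
Proof. by move=> ft; rewrite /csum -!rsum_inj// => i /ft ->. Qed.

End Reindexing.

(** * The Hilbert space of square summable families *)

Section L2.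
Variables (R : realType) (I : choiceType).

Definition sq_summable : {pred I -> R[i]} :=
  fun x => `[< nsummable (fun i => normc (x i) ^+ 2) >].

(** The square of |a x + y| is at most 2 |a|^2 |x|^2 + 2 |y|^2. *)
Fact sq_summable_submod : submod_closed sq_summable.
Proof.
split=> [|a x y /asboolP sx /asboolP sy]; apply/asboolP.
  under eq_fun do rewrite normc0 expr0n.
  exact: nsummable0.
have c0 : 0 <= 2 * normc a ^+ 2 by rewrite mulr_ge0// sqr_ge0.
have [s2 _] := nsumZ c0 sx.
have [s3 _] := nsumZ (ler0n R 2) sy.
apply: nsummable_le (nsummableD s2 s3) => i; rewrite sqr_ge0/=.
have := le_normcD (a * x i) (y i); rewrite normcM => h.
have -> : (a *: x + y) i = a * x i + y i by [].
have := normc_ge0 (a * x i + y i); have := normc_ge0 a.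
have := normc_ge0 (x i); have := normc_ge0 (y i); move: h.
move: (normc _) (normc (x i)) (normc (y i)) (normc a) => n p q c h q0 p0 d0 n0.
have : n ^+ 2 <= (c * p + q) ^+ 2 by rewrite lerXn2r ?nnegrE// addr_ge0 ?mulr_ge0.
have := sqr_ge0 (c * p - q); nra.
Qed.

HB.instance Definition _ :=
  GRing.isSubmodClosed.Build R[i] (I -> R[i]) sq_summable sq_summable_submod.

Record l2 : Type := L2 { l2val :> I -> R[i]; l2valP : l2val \in sq_summable }.

HB.instance Definition _ := [isSub for l2val].
HB.instance Definition _ := [Choice of l2 by <:].
HB.instance Definition _ := [SubChoice_isSubLmodule of l2 by <:].

Implicit Types x y z : l2.

Lemma l2_summable x : nsummable (fun i => normc (x i) ^+ 2).
Proof. by have /asboolP := l2valP x. Qed.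

Definition mk_l2 (f : I -> R[i]) (fs : nsummable (fun i => normc (f i) ^+ 2)) : l2 :=
  @L2 f (asboolT fs).

Lemma l2P x y : l2val x =1 l2val y -> x = y.
Proof. by move=> /funext e; exact: val_inj. Qed.

Lemma l2B x y i : l2val (x - y) i = x i - y i. Proof. by []. Qed.
Lemma l2Z a x i : l2val (a *: x) i = a * x i. Proof. by []. Qed.
Lemma l20 i : l2val 0 i = 0. Proof. by []. Qed.
Lemma l2_sum J (r : seq J) (P : pred J) (F : J -> l2) i :
  l2val (\sum_(j <- r | P j) F j) i = \sum_(j <- r | P j) F j i.
Proof. by elim/big_rec2: _ => // j y1 y2 _ <-. Qed.

Lemma l2_prod_summable x y : csummable (fun i => x i * (y i)^*%R).
Proof.
apply: nsummable_le (nsummableD (l2_summable x) (l2_summable y)) => i.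
rewrite normc_ge0/= normcM normc_conj.
have := sqr_ge0 (normc (x i) - normc (y i)).
have := normc_ge0 (x i); have := normc_ge0 (y i); nra.
Qed.

Definition l2_dot x y : R[i] := csum (fun i => x i * (y i)^*%R).

Fact l2_dotDl x y z : l2_dot (x + y) z = l2_dot x z + l2_dot y z.
Proof.
rewrite /l2_dot -csumD; [|exact: l2_prod_summable..].
by congr csum; apply/funext => i; rewrite -mulrDl.
Qed.

Fact l2_dotZl (a : R[i]) x z : l2_dot (a *: x) z = a * l2_dot x z.
Proof.
rewrite /l2_dot -csumZ; last exact: l2_prod_summable.
by congr csum; apply/funext => i; rewrite mulrA.
Qed.

Fact l2_dotC x y : l2_dot y x = (l2_dot x y)^*%R.
Proof.
rewrite /l2_dot -csum_conj; congr csum; apply/funext => i.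
by rewrite rmorphM/= conjCK mulrC.
Qed.

Lemma l2_dotxx x : l2_dot x x = (nsum (fun i => normc (x i) ^+ 2))%:C.
Proof.
rewrite -csum_real; last exact: l2_summable.
congr csum; apply/funext => i; by rewrite -normCK normCE rmorphXn.
Qed.

Fact l2_dot_ge0 x : 0 <= Re (l2_dot x x).
Proof. by rewrite l2_dotxx nsum_ge0//; exact: l2_summable. Qed.

Fact l2_dot_eq0 x : Re (l2_dot x x) = 0 -> x = 0.
Proof.
rewrite l2_dotxx /= => x0; apply: l2P => i; apply: eq0_normc; apply/eqP.
by rewrite -sqrf_eq0 eq_le sqr_ge0 -x0 (le_nsum1 i (l2_summable x)).
Qed.

Definition delta_fun (i j : I) : R[i] := (j == i)%:R.

Lemma delta_fun_sum i : nsummable (fun j => normc (delta_fun i j) ^+ 2) /\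
  nsum (fun j => normc (delta_fun i j) ^+ 2) <= 1.
Proof.
apply: nsummable_bound => [j|A]; first exact: sqr_ge0.
have dE j : normc (delta_fun i j) ^+ 2 = (j == i)%:R.
  by rewrite /delta_fun; case: eqP => _; rewrite ?normc1 ?normc0 ?expr1n ?expr0n.
under eq_bigr do rewrite dE.
rewrite -natr_sum lern1 -big_mkcond/= sum1_count.
by rewrite count_uniq_mem ?fset_uniq// leq_b1.
Qed.

Definition l2_delta (i : I) : l2 := mk_l2 (delta_fun_sum i).1.

End L2.

Section L2Hilbert.
Variables (R : realType) (G : groupType).
Implicit Types x y : l2 R G.

Fact l2_nonzero : exists x : l2 R G, x <> 0.
Proof.
exists (l2_delta R 1%g) => e.
have := congr1 (fun x : l2 R G => x 1%g) e.
by rewrite /= /delta_fun eqxx => /eqP; rewrite oner_eq0.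
Qed.

(** The limit exists in each coordinate. The estimate passes to the limit on
    every finite set of coordinates, hence on the whole sum. *)
Fact l2_complete (x : nat -> l2 R G) (e : nat -> R) : e @ \oo --> 0 ->
  (forall n m, (n <= m)%N ->
    Num.sqrt (Re (l2_dot (x n - x m) (x n - x m))) <= e n) ->
  exists l, forall n, Num.sqrt (Re (l2_dot (x n - l) (x n - l))) <= e n.
Proof.
move=> e0 xe.
have en n : 0 <= e n by rewrite (le_trans _ (xe n n (leqnn n)))// sqrtr_ge0.
have sumB n m (A : {fset G}) : (n <= m)%N ->
    \sum_(i <- A) normc (x n i - x m i) ^+ 2 <= e n ^+ 2.
  move=> nm; have := xe n m nm.
  rewrite -(@ler_pXn2r _ 2)// ?nnegrE ?sqrtr_ge0// sqr_sqrtr ?l2_dot_ge0//.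
  rewrite l2_dotxx; apply: le_trans; rewrite [leRHS]/=.
  exact: le_nsum (l2_summable (x n - x m)).
have /choice[l lP] i : exists l, (fun m => normc (l - x m i)) @ \oo --> (0 : R).
  apply: complex_seq_complete e0 _ => n m nm.
  rewrite -(@ler_pXn2r _ 2)// ?nnegrE ?normc_ge0//.
  by have := sumB n m [fset i]%fset nm; rewrite big_seq_fset1.
have limB n i : (fun m => normc (x n i - x m i) ^+ 2) @ \oo --> normc (x n i - l i) ^+ 2.
  have h : (fun m => normc (x n i - x m i)) @ \oo --> normc (x n i - l i).
    apply/cvgrPdist_le => d d0; have /cvgrPdist_le/(_ _ d0) := lP i.
    apply: filterS => m; rewrite sub0r normrN ger0_norm ?normc_ge0//.
    apply: le_trans; rewrite ler_norml.
    have := le_normcD (x n i - x m i) (x m i - l i).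
    have := le_normcD (x n i - l i) (l i - x m i).
    rewrite !addrA !subrK (normc_distC (x m i) (l i)).
    by move=> *; apply/andP; split; lra.
  by under eq_fun do rewrite expr2; rewrite expr2; apply: cvgM.
have sumL n (A : {fset G}) : \sum_(i <- A) normc (x n i - l i) ^+ 2 <= e n ^+ 2.
  apply: (@cvgr_to_le _ \oo _ _ (fun m => \sum_(i <- A) normc (x n i - x m i) ^+ 2)).
    elim: (enum_fset A) => [|i r ih].
      by rewrite big_nil; under eq_fun do rewrite big_nil; exact: cvg_cst.
    by rewrite big_cons; under eq_fun do rewrite big_cons; apply: cvgD.
  by exists n => // m /= nm; exact: sumB.
have tail n : nsummable (fun i => normc (x n i - l i) ^+ 2) /\
    nsum (fun i => normc (x n i - l i) ^+ 2) <= e n ^+ 2.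
  by apply: nsummable_bound => // i; exact: sqr_ge0.
pose d := mk_l2 (tail 0%N).1.
have dE n : l2_dot (x n - (x 0%N - d)) (x n - (x 0%N - d)) =
    (nsum (fun i => normc (x n i - l i) ^+ 2))%:C.
  rewrite l2_dotxx; congr (_%:C)%C; congr nsum; apply/funext => i.
  by rewrite !l2B -[l2val d i]/(x 0%N i - l i) subKr.
(* [l] itself is not known to be square summable, but x_0 - l is. *)
exists (x 0%N - d) => n; rewrite dE [Re _]/=.
by rewrite -(ger0_norm (en n)) -sqrtr_sqr ler_wsqrtr// (tail n).2.
Qed.

HB.instance Definition _ := Lmodule_isHilbert.Build R (l2 R G)
  (@l2_dotDl R G) (@l2_dotZl R G) (@l2_dotC R G) (@l2_dot_ge0 R G)
  (@l2_dot_eq0 R G) l2_nonzero l2_complete.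

Lemma l2_hnorm x : hnorm x ^+ 2 = nsum (fun i => normc (x i) ^+ 2).
Proof. by rewrite sqr_hnorm -[dot x x]/(l2_dot x x) l2_dotxx. Qed.

End L2Hilbert.

(** * The representation of the boundary quotient on square summable families *)

Section InjectionOperators.
Variables (R : realType) (G : groupType).
Implicit Types (x y : l2 R G) (t : G -> G).

Definition pushforward t (f : G -> R[i]) (i : G) : R[i] :=
  match pselect (exists j, t j = i) with
  | left e => f (projT1 (cid e))
  | right _ => 0
  end.

Lemma pushforward_in t f j : injective t -> pushforward t f (t j) = f j.
Proof.
move=> tinj; rewrite /pushforward; case: pselect => [e|[]]; last by exists j.
by case: cid => k /= /tinj ->.
Qed.

Lemma pushforward_out t f i : ~ range t i -> pushforward t f i = 0.
Proof.
rewrite /pushforward; case: pselect => // -[j tj] []; by exists j.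
Qed.

Lemma pushforward_summable t x : injective t ->
  nsummable (fun i => normc (pushforward t x i) ^+ 2).
Proof.
move=> tinj; apply: (nsummable_inj tinj) => [i|i /pushforward_out ->|].
- exact: sqr_ge0.
- by rewrite normc0 expr0n.
- rewrite (_ : _ \o _ = fun j => normc (x j) ^+ 2); first exact: l2_summable.
  by apply/funext => j /=; rewrite pushforward_in.
Qed.

Lemma pullback_summable t x : injective t ->
  nsummable (fun j => normc (x (t j)) ^+ 2).
Proof. by move=> tinj; exact: (nsummable_comp tinj (l2_summable x)). Qed.

Definition l2_pushforward t (tinj : injective t) x : l2 R G := mk_l2 (pushforward_summable x tinj).
Definition l2_pullback t (tinj : injective t) x : l2 R G := mk_l2 (pullback_summable x tinj).

(** The isometry that sends the basis vector at [j] to the basis vector at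
    [t j]; its adjoint is the composition with [t]. *)
Definition inj_op t (tinj : injective t) : bop (l2 R G).
Proof.
apply: (@mk_bop _ _ (l2_pushforward tinj) (l2_pullback tinj)) => [x y|].
  rewrite -[LHS]/(csum _) -[RHS]/(csum _) -(csum_inj tinj).
    by congr csum; apply/funext => j /=; rewrite pushforward_in.
  by move=> i /= ti; rewrite pushforward_out// mul0r.
exists 1 => x; rewrite mul1r -(@ler_pXn2r _ 2)// ?nnegrE ?hnorm_ge0//.
rewrite !l2_hnorm -(nsum_inj tinj); last first.
  by move=> i /pushforward_out /= ->; rewrite normc0 expr0n.
rewrite (_ : _ \o _ = fun j => normc (x j) ^+ 2)//.
by apply/funext => j /=; rewrite pushforward_in.
Defined.

Lemma inj_op_in t (tinj : injective t) x j :
  l2val (bfun (inj_op tinj) x) (t j) = x j.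
Proof. exact: pushforward_in. Qed.

Lemma inj_op_out t (tinj : injective t) x i : ~ range t i ->
  l2val (bfun (inj_op tinj) x) i = 0.
Proof. exact: pushforward_out. Qed.

Lemma star_inj_op t (tinj : injective t) x j :
  l2val (bfun (star (inj_op tinj)) x) j = x (t j).
Proof. by []. Qed.

Lemma inj_op_isometry t (tinj : injective t) :
  star (inj_op tinj) * inj_op tinj = 1.
Proof.
by apply: bopP => x; apply: l2P => j; rewrite bop_mulE star_inj_op inj_op_in.
Qed.

Lemma inj_opM t t' t'' (tinj : injective t) (tinj' : injective t')
    (tinj'' : injective t'') : t'' =1 t \o t' ->
  inj_op tinj'' = inj_op tinj * inj_op tinj'.
Proof.
move=> tE; apply: bopP => x; apply: l2P => i; rewrite bop_mulE.
have [[j _ <-]|ni] := pselect (range t i); last first.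
  rewrite !inj_op_out// => -[j _ ji]; apply: ni; exists (t' j) => //.
  by rewrite -ji tE.
rewrite inj_op_in; have [[k _ <-]|nj] := pselect (range t' j).
  by rewrite inj_op_in -[t (t' k)]/((t \o t') k) -tE inj_op_in.
rewrite !inj_op_out// => -[k _]; rewrite tE /= => /tinj kj; apply: nj.
by exists k.
Qed.

Lemma inj_op1 t (tinj : injective t) : t =1 id -> inj_op tinj = 1.
Proof.
move=> tE; apply: bopP => x; apply: l2P => i.
by rewrite bop_oneE -{1}(tE i) inj_op_in.
Qed.

End InjectionOperators.

Section Representation.
Variables (R : realType) (G : groupType) (P : monoidType).
Variable theta : P -> {multiplicative G -> G}.
Hypothesis hads : algebraic_dynamical_system theta.
Hypothesis PC : commutative (@monoid.mul P).

Lemma mulg_left_inj (g : G) : injective (monoid.mul g).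
Proof. exact: mulgI. Qed.

Definition left_translation (g : G) : bop (l2 R G) := inj_op R (@mulg_left_inj g).
Definition theta_op (p : P) : bop (l2 R G) := inj_op R (@ads_inj _ _ _ hads p).

Lemma translation_star g : star (left_translation g) = left_translation g^-1%g.
Proof.
apply: bopP => x; apply: l2P => h; rewrite star_inj_op.
by rewrite -{2}(mulKg g h) inj_op_in.
Qed.

Lemma translation1 : left_translation 1%g = 1.
Proof. by apply: inj_op1 => h; rewrite mul1g. Qed.

Lemma translationM g h : left_translation (g * h)%g = left_translation g * left_translation h.
Proof. by apply: inj_opM => k /=; rewrite mulgA. Qed.

Lemma right_ideal_mul (p q : P) : principal_right_ideal p (p * q)%g.
Proof. by exists q. Qed.

(** The product p q lies in both ideals because [P] is commutative, so the
    first alternative of the right LCM property never occurs. *)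
Lemma admissible_lcm (p q : P) : exists p' q', 
  principal_right_ideal p `&` principal_right_ideal q =
        principal_right_ideal (p * p')%g /\ (p * p' = q * q')%g.
Proof.
have [e|[r e]] := lcm_ideals (ads_monoid hads) p q.
  have : (principal_right_ideal p `&` principal_right_ideal q) (p * q)%g.
    by split; [|rewrite PC]; exact: right_ideal_mul.
  by rewrite e.
have : principal_right_ideal r r by exists 1%g => //; exact: mulg1.
rewrite -e => -[[p' _ p'r] [q' _ q'r]].
by exists p', q'; rewrite p'r q'r.
Qed.

Lemma theta_inv p g : theta p g^-1%g = (theta p g)^-1%g.
Proof.
apply: (mulgI (theta p g)); rewrite mulgV -gmulfM mulgV.
by apply: (mulgI (theta p 1%g)); rewrite -gmulfM !mulg1.
Qed.

Lemma translation_theta_op_in g p (x : l2 R G) h :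
  l2val (bfun (left_translation g) (bfun (theta_op p) x)) (g * theta p h)%g = x h.
Proof. by rewrite !inj_op_in. Qed.

Lemma translation_theta_op_out g p (x : l2 R G) k : (forall h, k <> (g * theta p h)%g) ->
  l2val (bfun (left_translation g) (bfun (theta_op p) x)) k = 0.
Proof.
move=> kP; rewrite -(mulVKg g k) inj_op_in inj_op_out// => -[h _ hk].
by apply: (kP h); rewrite hk mulVKg.
Qed.

(** Each relation is a statement about coordinates. In (II), an equality
    theta p h = g (theta q k) puts theta q (g2 k) in the ranges of both
    [theta p] and [theta q]; since [theta] respects the order it lies in the
    range of [theta (p * p')], which is the support of the right-hand side. In
    (III), exactly one coset contains a given coordinate. *)
Lemma l2_boundary_relations : boundary_relations theta left_translation theta_op.
Proof.
split.
- move=> g; rewrite /unitary translation_star -!translationM mulVg mulgV.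
  by split; exact: translation1.
- exact: translation1.
- exact: translationM.
- by move=> p; exact: inj_op_isometry.
- by apply: inj_op1 => h; exact: (ads1 hads).
- by move=> p q; apply: inj_opM => h; exact: (adsM hads).
- move=> p g; have inj : injective (fun h => theta p (g * h)%g).
    by move=> h k /(ads_inj hads)/mulgI.
  rewrite -(@inj_opM _ _ _ _ _ _ _ inj)// -(@inj_opM _ _ _ _ _ _ _ inj)//.
  by move=> h /=; rewrite gmulfM.
- move=> p q g g1 g2 p' q' [gE pq_ideal pq_eq].
  apply: bopP => x; apply: l2P => h; rewrite !bop_mulE star_inj_op.
  have [[k hE]|nh] := pselect (exists k, h = (g1 * theta p' k)%g).
    rewrite hE translation_theta_op_in star_inj_op.
    have -> : (theta p (g1 * theta p' k) =
               g * theta q (g2^-1 * theta q' k))%g.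
      rewrite !gmulfM gE -!(adsM hads) pq_eq theta_inv.
      by rewrite -mulgA mulVKg.
    by rewrite translation_theta_op_in -{2}(mulVKg g2 (theta q' k)) inj_op_in.
  rewrite [RHS]translation_theta_op_out => [|k hk]; last by apply: nh; exists k.
  rewrite translation_theta_op_out// => k hk.
  have : (range (theta p) `&` range (theta q)) (theta q (g2 * k))%g.
    split; [exists (g1^-1 * h)%g|by exists (g2 * k)%g] => //.
    by rewrite !gmulfM hk gE theta_inv -!mulgA mulKg.
  rewrite (ads_order hads pq_ideal) => -[l _]; rewrite (adsM hads) => lk.
  apply: nh; exists l; apply: (@ads_inj _ _ _ hads p).
  by rewrite gmulfM lk hk gE -mulgA gmulfM.
- move=> p q g nadm; apply: bopP => x; apply: l2P => h.
  rewrite !bop_mulE star_inj_op bop_zeroE l20 translation_theta_op_out// => k hk.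
  apply: nadm; have [p' [q' [pq_ideal pq_eq]]] := admissible_lcm p q.
  exists h, k^-1%g, p', q'; split=> //.
  by rewrite theta_inv hk mulgK.
- move=> p fin; apply: bopP => x; apply: l2P => h.
  (* The coset of [h]. *)
  pose X0 : set G := [set (h * k)%g | k in range (theta p)].
  have X0in : X0 \in fset_set (cosets theta p).
    by rewrite in_fset_set// inE; exists h.
  have term X : X \in fset_set (cosets theta p) ->
      l2val (bfun (left_translation (xget 1%g X) * theta_op p * star (theta_op p) *
                   star (left_translation (xget 1%g X))) x) h = if X == X0 then x h else 0.
    rewrite in_fset_set// inE => -[k _ XE].
    have : X (xget 1%g X).
      apply: (xgetPex 1%g (P := X)); rewrite -XE; exists (k * theta p 1)%g.
      by exists (theta p 1)%g => //; exists 1%g.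
    set g := xget 1%g X => Xg; rewrite !bop_mulE.
    have [[l hl]|nl] := pselect (exists l, h = (g * theta p l)%g).
      rewrite [in LHS]hl translation_theta_op_in -[LHS]/(l2val x (g * theta p l)%g) -hl.
      rewrite ifT//; apply/eqP; rewrite -XE /X0 hl.
      move: Xg; rewrite -XE => -[_ [j _ <-] <-].
      apply/seteqP; split=> _ [_ [i _ <-] <-].
        exists (theta p (l^-1 * (j^-1 * i)))%g; first by exists (l^-1 * (j^-1 * i))%g.
        by rewrite -!mulgA -!gmulfM mulVKg mulVKg.
      exists (theta p (j * (l * i)))%g; first by exists (j * (l * i))%g.
      by rewrite -!mulgA -!gmulfM.
    rewrite translation_theta_op_out; last by move=> i hi; apply: nl; exists i.
    case: eqP => // XX0; exfalso; apply: nl.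
    move: Xg; rewrite XX0 => -[_ [j _ <-] gE]; exists j^-1%g.
    by rewrite -gE -mulgA -gmulfM mulgV -[X in theta p X](mulgV 1%g) gmulfM
      theta_inv mulgV mulg1.
  rewrite fsbig_finite//= bop_sumE l2_sum bop_oneE.
  rewrite (eq_big_seq (fun X => if X == X0 then x h else 0)) => [|X Xin]; last exact: term.
  rewrite (big_fsetD1 X0)//= eqxx big_seq big1 ?addr0// => X.
  by rewrite !inE => /andP[/negPf ->].
Qed.

End Representation.

(** * Characters of an abelian group are dominated by the regular representation *)

Section Growth.
Variable R : realType.

Lemma bernoulli_le (t : R) n : 1 <= t -> 1 + n%:R * (t - 1) <= t ^+ n.
Proof.
move=> t1; elim: n => [|n ih]; first by rewrite mul0r addr0 expr0.
rewrite exprS -natr1; have t0 : 0 <= t by rewrite (le_trans _ t1).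
have := ler_wpM2l t0 ih.
have := mulr_ge0 (ler0n R n) (sqr_ge0 (t - 1)).
by move: (n%:R) (t ^+ n) => a b; rewrite expr2; lra.
Qed.

(** Write q = t^2 and q^n = t^n t^n: by induction one factor exceeds the
    power of exponent [k], and by the Bernoulli inequality the other one
    exceeds the remaining linear factor. *)
Lemma exp_gt_poly k (q C : R) : 1 < q -> exists n, C * n.+1%:R ^+ k < q ^+ n.
Proof.
elim: k q C => [|k ih] q C q1.
  exists (Num.bound `|C / (q - 1)|); rewrite expr0 mulr1.
  have q0 : 0 < q - 1 by rewrite subr_gt0.
  apply: lt_le_trans (bernoulli_le _ (ltW q1)).
  rewrite ltr_pwDl// -ler_pdivrMr//.
  by rewrite (le_trans (ler_norm _))// ltW// archi_boundP.
pose t := Num.sqrt q.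
have t0 : 0 <= t by exact: sqrtr_ge0.
have qE : q = t ^+ 2 by rewrite sqr_sqrtr// ltW// (lt_trans ltr01).
have t1 : 1 < t by move: q1; rewrite qE; nra.
pose c := Num.min 1 (t - 1).
have c0 : 0 < c by rewrite lt_min ltr01 subr_gt0.
have [n nP] := ih t (`|C| / c) t1.
exists n; rewrite qE -exprM mulnC mulnS muln1 exprD.
have lin : c * n.+1%:R <= t ^+ n.
  apply: le_trans (bernoulli_le n (ltW t1)).
  rewrite -natr1 mulrDr mulr1 addrC lerD ?ge_min ?lexx//.
  by rewrite mulrC ler_wpM2l// ge_min lexx orbT.
have -> : C * n.+1%:R ^+ k.+1 = (C / c * n.+1%:R ^+ k) * (c * n.+1%:R).
  by rewrite exprS; field; rewrite gt_eqF.
apply: (@le_lt_trans _ _ (`|C| / c * n.+1%:R ^+ k * (c * n.+1%:R))).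
  rewrite ler_pM2r ?mulr_gt0 ?ltr0n// ler_pM2r ?exprn_gt0 ?ltr0n//.
  by rewrite ler_pM2r ?invr_gt0// ler_norm.
apply: (@lt_le_trans _ _ (t ^+ n * (c * n.+1%:R))).
  by rewrite ltr_pM2r ?mulr_gt0 ?ltr0n.
by rewrite ler_wpM2l// exprn_ge0.
Qed.

Lemma le_of_poly_growth k (r m : R) : 0 <= r -> 0 <= m ->
  (forall n, r ^+ n <= m ^+ n * n.+1%:R ^+ k) -> r <= m.
Proof.
move=> r0 m0 h; rewrite leNgt; apply/negP => mr.
have [mz|mn] := eqVneq m 0.
  by have := h 1%N; rewrite !expr1 mz mul0r leNgt -mz mr.
have mp : 0 < m by rewrite lt_def mn.
have q1 : 1 < r / m by rewrite ltr_pdivlMr// mul1r.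
have [n] := exp_gt_poly k 1 q1.
rewrite mul1r ltNge expr_div_n ler_pdivrMr ?exprn_gt0// mulrC.
by rewrite h.
Qed.

End Growth.

Section Box.
Variable G : groupType.
Hypothesis GC : commutative (@monoid.mul G).
Implicit Types (gs : seq G) (g h : G).

(** A list rather than a set, because only an upper bound for the number of
    products is needed, which is polynomial in [n]; repetitions are
    harmless. *)
Fixpoint box gs (n : nat) : seq G :=
  if gs is g :: gs' then [seq (g ^+ i * h)%g | i <- iota 0 n.+1, h <- box gs' n]
  else [:: 1%g].

Lemma size_box gs n : size (box gs n) = (n.+1 ^ size gs)%N.
Proof.
elim: gs => [|g gs ih]; first by rewrite expn0.
rewrite -[box _ _]/[seq (g ^+ i * h)%g | i <- iota 0 n.+1, h <- box gs n].
by rewrite size_allpairs size_iota ih expnS.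
Qed.

Lemma box_consP g gs n h : h \in box (g :: gs) n <->
  exists i k, [/\ (i <= n)%N, k \in box gs n & h = (g ^+ i * k)%g].
Proof.
rewrite -[box _ _]/[seq (g ^+ i * h)%g | i <- iota 0 n.+1, h <- box gs n].
split=> [/allpairsP[[i k] [iin kin ->]]|[i [k [iin kin ->]]]].
  by rewrite mem_iota add0n in iin; exists i, k.
by apply/allpairsP; exists (i, k); rewrite mem_iota add0n.
Qed.

Lemma one_in_box gs n : 1%g \in box gs n.
Proof.
elim: gs => [|g gs ih]; first by rewrite inE.
by apply/box_consP; exists 0%N, 1%g; split; rewrite ?expg0 ?mulg1.
Qed.

Lemma box_leq gs n h : h \in box gs n -> h \in box gs n.+1.
Proof.
elim: gs h => [|g gs ih] h // /box_consP[i [k [iin kin ->]]].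
by apply/box_consP; exists i, k; split; [exact: leqW|exact: ih|].
Qed.

(** Commutativity lets the new factor join the power of the same element. *)
Lemma box_mul gs n g h : g \in gs -> h \in box gs n -> (h * g)%g \in box gs n.+1.
Proof.
elim: gs h => [//|g0 gs ih] h gin /box_consP[i [k [iin kin ->]]].
apply/box_consP; move: gin; rewrite inE => /predU1P[->|gin].
  by exists i.+1, k; split; [|exact: box_leq|rewrite -mulgA (GC k) mulgA -expgSr].
by exists i, (k * g)%g; split; [exact: leqW|exact: ih|rewrite mulgA].
Qed.

End Box.

Lemma char1 (K : numClosedFieldType) (G : groupType) (eta : pontryagin K G) :
  eta 1%g = 1.
Proof. by apply: (mulfI (char_neq0 eta 1%g)); rewrite -charM mulg1 mulr1. Qed.

Lemma charV (K : numClosedFieldType) (G : groupType) (eta : pontryagin K G) g :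
  eta g^-1%g = (eta g)^*%R.
Proof.
apply: (mulfI (char_neq0 eta g)); rewrite -charM mulgV char1.
by rewrite -normCK norm_char expr1n.
Qed.

Section RegularRepresentationNorm.
Variables (R : realType) (G : groupType).
Hypothesis GC : commutative (@monoid.mul G).
Variable eta : pontryagin R[i] G.

Definition poly_eval (p : seq (R[i] * G)) : R[i] := \sum_(x <- p) x.1 * eta x.2.

Definition poly_in (A : algType R[i]) (u : G -> A) (p : seq (R[i] * G)) : A :=
  \sum_(x <- p) x.1 *: u x.2.

(** The character [eta] cut off outside a box. The inverse appears because
    translation by [g] sends a function [x] to [fun h => x (g^-1 * h)]; away
    from the boundary of the box the vector is an eigenvector of all
    translations by elements of [gs]. *)
Definition box_vec_fun gs N (h : G) : R[i] :=
  if h^-1%g \in box gs N then eta h^-1%g else 0.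

Lemma box_vec_sum gs N :
  nsummable (fun h => normc (box_vec_fun gs N h) ^+ 2) /\
  nsum (fun h => normc (box_vec_fun gs N h) ^+ 2) <= N.+1%:R ^+ size gs.
Proof.
apply: nsummable_bound => [h|A]; first exact: sqr_ge0.
have vE h : normc (box_vec_fun gs N h) ^+ 2 = (h^-1%g \in box gs N)%:R.
  rewrite /box_vec_fun; case: ifP => _; last by rewrite normc0 expr0n.
  have [->] : normc (eta h^-1%g) = 1 by have [] := norm_char eta h^-1%g.
  by rewrite expr1n.
under eq_bigr do rewrite vE.
rewrite -natr_sum -natrX ler_nat -size_box -big_mkcond/= sum1_count -size_filter.
rewrite -(size_map (@monoid.inv G)); apply: uniq_leq_size.
  rewrite map_inj_uniq; last exact: invg_inj.
  by rewrite filter_uniq ?fset_uniq.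
by move=> _ /mapP[h hin ->]; move: hin; rewrite mem_filter => /andP[].
Qed.

Definition box_vec gs N : l2 R G := mk_l2 (box_vec_sum gs N).1.

Lemma poly_translation_eval p (x : l2 R G) h :
  l2val (bfun (poly_in (@left_translation R G) p) x) h = \sum_(y <- p) y.1 * x (y.2^-1 * h)%g.
Proof.
rewrite bop_sumE l2_sum; apply: eq_bigr => y _.
by rewrite bop_scaleE l2Z -{1}(mulVKg y.2 h) inj_op_in.
Qed.

(** Each application of the operator spoils one layer of the box, so a box
    that is larger by [n] leaves an exact eigenvector equation after [n]
    steps. *)
Lemma poly_translation_iter p n N h : h^-1%g \in box (unzip2 p) N ->
  l2val (iter n (bfun (poly_in (@left_translation R G) p)) (box_vec (unzip2 p) (n + N))) h =
  poly_eval p ^+ n * eta h^-1%g.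
Proof.
elim: n N h => [|n ih] N h hin.
  by rewrite /= /box_vec_fun hin expr0 mul1r.
rewrite iterS poly_translation_eval exprS /poly_eval -mulrA mulr_suml.
apply: eq_big_seq => y yp; rewrite addSnnS ih; last first.
  rewrite invgM invgK; apply: (box_mul GC) => //.
  by apply/mapP; exists y.
by rewrite invgM invgK charM -/(poly_eval p); ring.
Qed.

(** With the box of size [n], the coordinate at 1 of the [n]-th iterate is the
    [n]-th power of the value at [eta], whereas the vector has norm at most
    (n + 1)^(k / 2) for a polynomial with [k] terms. This factor is negligible
    after extraction of [n]-th roots. The argument replaces the amenability of
    abelian groups. *)
Lemma poly_eval_le p (M : R) : 0 <= M ->
  (forall x : l2 R G, hnorm (bfun (poly_in (@left_translation R G) p) x) <= M * hnorm x) ->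
  normc (poly_eval p) <= M.
Proof.
move=> M0 Mp; set a := poly_in _ _ in Mp.
rewrite -(@ler_pXn2r _ 2)// ?nnegrE ?normc_ge0//.
apply: (@le_of_poly_growth _ (size p)); rewrite ?sqr_ge0// => n.
have iter_le m (x : l2 R G) : hnorm (iter m (bfun a) x) <= M ^+ m * hnorm x.
  elim: m => [|m ih]; first by rewrite mul1r.
  by rewrite iterS (le_trans (Mp _))// exprS -mulrA ler_wpM2l.
pose v := box_vec (unzip2 p) n.
have := @poly_translation_iter p n 0%N 1%g; rewrite invg1 addn0 => /(_ (one_in_box _ _)).
rewrite char1 mulr1 => ve; rewrite -!exprM mulnC !exprM -normcX -ve.
rewrite (le_trans (le_nsum1 1%g (l2_summable _)))// -l2_hnorm.
apply: (@le_trans _ _ ((M ^+ n * hnorm v) ^+ 2)).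
  by rewrite lerXn2r ?nnegrE ?mulr_ge0 ?exprn_ge0 ?hnorm_ge0.
rewrite exprMn ler_wpM2l ?sqr_ge0// l2_hnorm.
by have [_] := box_vec_sum (unzip2 p) n; rewrite size_map.
Qed.

End RegularRepresentationNorm.

(** * Trigonometric polynomials *)

Section Polynomials.
Variables (R : realType) (G : groupType).
Implicit Types (p q : seq (R[i] * G)) (c : R[i]).

Definition poly_scale c p := [seq (c * x.1, x.2) | x <- p].
Definition poly_mul p q := [seq (x.1 * y.1, (x.2 * y.2)%g) | x <- p, y <- q].
Definition poly_star p := [seq ((x.1^*)%R, x.2^-1%g) | x <- p].
Definition poly_map (f : G -> G) p := [seq (x.1, f x.2) | x <- p].

Section Eval.
Variable eta : pontryagin R[i] G.

Lemma poly_eval_cat p q : poly_eval eta (p ++ q) = poly_eval eta p + poly_eval eta q.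
Proof. by rewrite /poly_eval big_cat. Qed.

Lemma poly_eval_scale c p : poly_eval eta (poly_scale c p) = c * poly_eval eta p.
Proof.
by rewrite /poly_eval big_map mulr_sumr; apply: eq_bigr => x _; rewrite mulrA.
Qed.

Lemma poly_eval_mul p q : poly_eval eta (poly_mul p q) = poly_eval eta p * poly_eval eta q.
Proof.
rewrite /poly_eval big_allpairs_dep big_distrl; apply: eq_bigr => x _ /=.
by rewrite big_distrr; apply: eq_bigr => y _ /=; rewrite charM mulrACA.
Qed.

Lemma poly_eval_star p : poly_eval eta (poly_star p) = (poly_eval eta p)^*%R.
Proof.
rewrite /poly_eval big_map rmorph_sum; apply: eq_bigr => x _ /=.
by rewrite charV rmorphM.
Qed.

End Eval.

Section InAlgebra.
Variables (A : cstarAlgType R[i]) (u : G -> A).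

Lemma poly_in_cat p q : poly_in u (p ++ q) = poly_in u p + poly_in u q.
Proof. by rewrite /poly_in big_cat. Qed.

Lemma poly_in_scale c p : poly_in u (poly_scale c p) = c *: poly_in u p.
Proof.
by rewrite /poly_in big_map scaler_sumr; apply: eq_bigr => x _; rewrite scalerA.
Qed.

Hypothesis uM : forall g h, u (g * h)%g = u g * u h.
Hypothesis uV : forall g, star (u g) = u g^-1%g.

Lemma poly_in_mul p q : poly_in u (poly_mul p q) = poly_in u p * poly_in u q.
Proof.
rewrite /poly_in big_allpairs_dep mulr_suml; apply: eq_bigr => x _ /=.
rewrite mulr_sumr; apply: eq_bigr => y _ /=.
by rewrite uM -scalerAl -scalerAr scalerA.
Qed.

Lemma star_sum I (r : seq I) (F : I -> A) :
  star (\sum_(i <- r) F i) = \sum_(i <- r) star (F i).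
Proof.
elim: r => [|i r ih]; first by rewrite !big_nil star0.
by rewrite !big_cons starD ih.
Qed.

Lemma poly_in_star p : poly_in u (poly_star p) = star (poly_in u p).
Proof.
rewrite /poly_in big_map star_sum; apply: eq_bigr => x _ /=.
by rewrite starZ uV.
Qed.

(** The elements that can be approximated by polynomials form a
    C*-algebra. *)
Lemma generated_approx a : cstar_generated (range u) a ->
  forall e : R, 0 < e -> exists p, rnorm (a - poly_in u p) < e.
Proof.
pose E : set A := [set a | forall e : R, 0 < e -> exists p, rnorm (a - poly_in u p) < e].
suff : cstar_generated (range u) `<=` E by move=> h /h.
have Ein p : E (poly_in u p) by move=> e e0; exists p; rewrite subrr rnorm0.
apply: smallest_sub; last first.
  move=> _ [g _ <-]; have := Ein [:: (1, g)].
  by rewrite /poly_in big_seq1 scale1r.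
split.
- by have := Ein [::]; rewrite /poly_in big_nil.
- move=> x y xE yE e e0; have e2 : 0 < e / 2 by rewrite divr_gt0.
  have [p pP] := xE _ e2; have [q qP] := yE _ e2.
  exists (p ++ q); rewrite poly_in_cat opprD addrACA.
  by rewrite (le_lt_trans (rnormD _ _))//; lra.
- move=> c x xE e e0.
  (* Here and below, the summand 1 keeps the denominator positive. *)
  have cp : 0 < normc c + 1 by rewrite ltr_wpDl ?normc_ge0.
  have [|p pP] := xE (e / (normc c + 1)); first by rewrite divr_gt0.
  exists (poly_scale c p); rewrite poly_in_scale -scalerBr rnormZ.
  move: pP; rewrite ltr_pdivlMr// => pP.
  by have := normc_ge0 c; have := rnorm_ge0 (x - poly_in u p); nra.
- move=> x y xE yE e e0.
  have yp : 0 < rnorm y + 1 by rewrite ltr_wpDl ?rnorm_ge0.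
  have [|p pP] := xE (e / 2 / (rnorm y + 1)); first by rewrite !divr_gt0.
  set P := poly_in u p in pP.
  have pp : 0 < rnorm P + 1 by rewrite ltr_wpDl ?rnorm_ge0.
  have [|q qP] := yE (e / 2 / (rnorm P + 1)); first by rewrite !divr_gt0.
  exists (poly_mul p q); rewrite poly_in_mul -/P; set Q := poly_in u q in qP *.
  have -> : x * y - P * Q = (x - P) * y + P * (y - Q).
    by rewrite mulrBl mulrBr addrA subrK.
  rewrite (le_lt_trans (rnormD _ _))//.
  move: pP qP; rewrite !ltr_pdivlMr// => pP qP.
  have := rnormM (x - P) y; have := rnormM P (y - Q).
  have := rnorm_ge0 (x - P); have := rnorm_ge0 (y - Q).
  have := rnorm_ge0 P; have := rnorm_ge0 y; nra.
- move=> x xE e e0; have [p pP] := xE e e0.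
  by exists (poly_star p); rewrite poly_in_star -starB rnorm_star.
- apply/closed_approx => x xE e e0; have e2 : 0 < e / 2 by rewrite divr_gt0.
  have [y yE xy] := xE _ e2; have [p pP] := yE _ e2; exists p.
  by rewrite (le_lt_trans (rnorm_triangle y _ _))//; lra.
Qed.

End InAlgebra.
End Polynomials.

(** * Consequences of the universal property *)

Section BoundaryQuotient.
Variables (R : realType) (G : groupType) (P : monoidType).
Variable theta : P -> {multiplicative G -> G}.
Variables (A : cstarAlgType R[i]) (u : G -> A) (s : P -> A).

Lemma boundary_relations_morph (B : cstarAlgType R[i]) (phi : {lrmorphism A -> B}) :
  star_morphism phi -> boundary_relations theta u s ->
  boundary_relations theta (phi \o u) (phi \o s).
Proof.
move=> phis [ru r1 rM ri rs1 rsM rI rII rII0 rIII]; split=> /=.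
- move=> g; have [h1 h2] := ru g; split; rewrite -phis -rmorphM.
    by rewrite h1 rmorph1.
  by rewrite h2 rmorph1.
- by rewrite r1 rmorph1.
- by move=> g h; rewrite rM rmorphM.
- by move=> p; rewrite -phis -rmorphM ri rmorph1.
- by rewrite rs1 rmorph1.
- by move=> p q; rewrite rsM rmorphM.
- by move=> p g; rewrite -!rmorphM rI.
- by move=> p q g g1 g2 p' q' /rII e; rewrite -!phis -!rmorphM e.
- by move=> p q g /rII0 e; rewrite -phis -!rmorphM e rmorph0.
- move=> p fin; rewrite -(rmorph1 phi) -(rIII p fin) !fsbig_finite//= rmorph_sum.
  by apply: eq_bigr => X _; rewrite -!phis -!rmorphM.
Qed.

Hypothesis hQ : boundary_quotient theta u s.

(** The images of the generators under a star morphism satisfy the boundary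
    relations again, so the uniqueness part of the universal property
    applies. *)
Lemma boundary_quotient_ext (B : cstarAlgType R[i]) (phi psi : {lrmorphism A -> B}) :
  star_morphism phi -> star_morphism psi ->
  (forall g, phi (u g) = psi (u g)) -> (forall p, phi (s p) = psi (s p)) ->
  phi =1 psi.
Proof.
move=> phis psis eu es.
have [chi [_ _ _ chi_unique]] := bq_universal hQ
  (boundary_relations_morph phis (bq_relations hQ)).
move=> a; rewrite (chi_unique phi)//; apply/esym/chi_unique => // x /=.
  by rewrite eu.
by rewrite es.
Qed.

Hypothesis hads : algebraic_dynamical_system theta.
Hypothesis GC : commutative (@monoid.mul G).
Hypothesis PC : commutative (@monoid.mul P).

(** The morphism to the operators on square summable families provided by the
    universal property is contractive and turns the element into a polynomial
    in translations. *)
Lemma poly_eval_le_rnorm (eta : pontryagin R[i] G) p :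
  normc (poly_eval eta p) <= rnorm (poly_in u p).
Proof.
have [phi [phis phiu _ _]] := bq_universal hQ (l2_boundary_relations R hads PC).
apply: (poly_eval_le GC); first exact: rnorm_ge0.
move=> x; have -> : poly_in (@left_translation R G) p = phi (poly_in u p).
  rewrite /poly_in rmorph_sum; apply: eq_bigr => y _ /=.
  by rewrite linearZ/= phiu.
exact: star_morphism_contractive.
Qed.

Let ru := rel_unitary (bq_relations hQ).
Let uM := rel_uM (bq_relations hQ).

Lemma star_u g : star (u g) = u g^-1%g.
Proof.
have [h1 h2] := ru g.
rewrite -[LHS]mulr1 -(rel_u1 (bq_relations hQ)) -(mulgV g) uM mulrA h1 mul1r.
by [].
Qed.

Section Gauge.
Variable gamma : pontryagin R[i] (grothendieck PC) -> {lrmorphism A -> A}.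
Hypothesis hgamma : gauge_action u s gamma.

Lemma gauge_u chi g : gamma chi (u g) = u g.
Proof.
have := (hgamma chi).2 g 1%g; rewrite (rel_s1 (bq_relations hQ)) mulr1 => ->.
by rewrite -[groth_in PC 1%g]/(1%g : grothendieck PC) char1 scale1r.
Qed.

Lemma gauge_s chi p : gamma chi (s p) = chi (groth_in PC p) *: s p.
Proof.
by have := (hgamma chi).2 1%g p; rewrite (rel_u1 (bq_relations hQ)) !mul1r.
Qed.

Lemma gauge_group_action : group_action gamma.
Proof.
split.
- by move=> chi; have [] := hgamma chi.
- apply: (@boundary_quotient_ext A (gamma 1%g) idfun) => //.
  + by have [] := hgamma 1%g.
  + by move=> g; rewrite gauge_u.
  + by move=> p; rewrite gauge_s -[char_fun _ _]/(1 : R[i]) scale1r.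
- move=> t t'.
  apply: (@boundary_quotient_ext A (gamma (t * t')%g) (gamma t \o gamma t')) => /=.
  + by have [] := hgamma (t * t')%g.
  + by move=> x /=; rewrite !(fun t => (hgamma t).1).
  + by move=> g; rewrite !gauge_u.
  + move=> p; rewrite !gauge_s linearZ/= gauge_s scalerA mulrC.
    by [].
Qed.

End Gauge.
End BoundaryQuotient.

(** * The continuous function defined by an element of the group algebra *)

Lemma complex_seq_limit (R : realType) (a : nat -> R[i]) (e : nat -> R) :
  e @ \oo --> 0 -> (forall n m, (n <= m)%N -> normc (a n - a m) <= e n) ->
  exists l, forall n, normc (a n - l) <= e n.
Proof.
move=> e0 ae; have [l lP] := complex_seq_complete e0 ae; exists l => n.
apply/ler_addgt0Pr => d d0.
have /cvgrPdist_le/(_ _ d0)[m _ mP] := lP.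
have := mP (maxn n m) (leq_maxr _ _).
rewrite sub0r normrN ger0_norm ?normc_ge0// => ld.
have := le_normcD (a n - a (maxn n m)) (a (maxn n m) - l).
rewrite addrA subrK (normc_distC _ l).
have := ae n (maxn n m) (leq_maxl _ _); lra.
Qed.

Lemma pontryagin_eval_continuous (K : numClosedFieldType) (G : groupType) (g : G) :
  continuous (fun eta : pontryagin K G => eta g).
Proof.
move=> eta U; rewrite nbhsE => -[V [oV Vg] VU].
apply: (filterS (P := [set x : pontryagin K G | V (x g)])).
  by move=> x /= /VU.
have oW : open ([set h | h @` [set g] `<=` V] :
    set {compact-open, discrete_topology G -> K}).
  apply: compact_open_open oV; exact: compact_set1.
apply: open_nbhs_nbhs; split=> //.
exists [set h : {compact-open, discrete_topology G -> K} | h @` [set g] `<=` V] => //.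
apply/seteqP; split=> x /=.
  by apply; exists g.
by move=> Vx _ [_ -> <-].
Qed.

Lemma uniform_limit_continuous (K : numClosedFieldType) (T : topologicalType)
    (f : T -> K) :
  (forall e : K, 0 < e -> exists2 g : T -> K, continuous g &
     forall x, `|g x - f x| < e) -> continuous f.
Proof.
move=> approx x; apply/cvgrPdist_lt => e e0.
have e3 : 0 < e / 3 by rewrite divr_gt0.
have [g gc gf] := approx _ e3.
have /cvgrPdist_lt/(_ _ e3) := gc x.
apply: filterS => y gxy.
have -> : f x - f y = (f x - g x) + ((g x - g y) + (g y - f y)).
  by rewrite !addrA !subrK.
have -> : e = e / 3 + (e / 3 + e / 3) by field.
rewrite (le_lt_trans (ler_normD _ _))// ltrD//; first by rewrite distrC.
by rewrite (le_lt_trans (ler_normD _ _))// ltrD.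
Qed.

Lemma lincomb_continuous (K : numClosedFieldType) (T : topologicalType)
    (J : Type) (F : J -> T -> K) (r : seq (K * J)) :
  (forall j, continuous (F j)) ->
  continuous (fun t => \sum_(x <- r) x.1 * F x.2 t).
Proof.
move=> Fc; elim: r => [|x r ih].
  rewrite (_ : (fun t => _) = fun=> 0); first exact: cst_continuous.
  by apply/funext => t; rewrite big_nil.
rewrite (_ : (fun t => _) =
    fun t => x.1 * F x.2 t + \sum_(y <- r) y.1 * F y.2 t); last first.
  by apply/funext => t; rewrite big_cons.
move=> t; apply: cvgD; last exact: ih.
exact: cvgM (cvg_cst _) (Fc x.2 t).
Qed.

Section Symbol.
Variables (R : realType) (G : groupType) (P : monoidType).
Variable theta : P -> {multiplicative G -> G}.
Variables (A : cstarAlgType R[i]) (u : G -> A) (s : P -> A).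
Hypothesis hQ : boundary_quotient theta u s.
Hypothesis hads : algebraic_dynamical_system theta.
Hypothesis GC : commutative (@monoid.mul G).
Hypothesis PC : commutative (@monoid.mul P).

Let rel := bq_relations hQ.
Let D : set A := cstar_generated (range u).

(** Evaluation at characters is bounded by the norm uniformly in [eta], so the
    evaluations of polynomials that converge to [v] converge uniformly. The
    limit is the Gelfand transform of [v], defined on the whole dual group. *)
Lemma generated_symbol (v : A) : D v -> exists f : pontryagin R[i] G -> R[i],
  continuous (f : pontryagin R[i] G -> (R[i] : numClosedFieldType)) /\
  forall (e : R) , 0 < e -> exists2 p, rnorm (v - poly_in u p) < e &
    forall eta, normc (poly_eval eta p - f eta) < e.
Proof.
move=> Dv.
have e0 n : 0 < (2^-1 : R) ^+ n by rewrite exprn_gt0// invr_gt0.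
have /choice[p pP] n :=
  generated_approx (rel_uM rel) (star_u hQ) Dv (e0 n).
have le_eval eta n m : (n <= m)%N ->
    normc (poly_eval eta (p n) - poly_eval eta (p m)) <= 2 * 2^-1 ^+ n.
  move=> nm; rewrite -mulN1r -poly_eval_scale -poly_eval_cat.
  rewrite (le_trans (poly_eval_le_rnorm hQ hads GC PC _ _))//.
  rewrite poly_in_cat poly_in_scale scaleN1r.
  have := rnorm_triangle v (poly_in u (p n)) (poly_in u (p m)).
  rewrite (rnorm_distC _ v).
  have : (2^-1 : R) ^+ m <= 2^-1 ^+ n.
    by rewrite ler_wiXn2l// ?invr_ge0// invf_le1// ler1n.
  by have := pP n; have := pP m; lra.
have /choice[f fP] (eta : pontryagin R[i] G) := complex_seq_limit (@geom_cvg0 R) (le_eval eta).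
have approx (e : R) : 0 < e -> exists2 q, rnorm (v - poly_in u q) < e &
    forall eta, normc (poly_eval eta q - f eta) < e.
  move=> ep; have /cvgrPdist_lt/(_ _ ep)[n _ /(_ n (leqnn _))] := @geom_cvg0 R.
  rewrite sub0r normrN ger0_norm ?mulr_ge0// ?ltW// => ne.
  exists (p n) => [|eta]; last exact: le_lt_trans (fP eta n) ne.
  by have := pP n; have := e0 n; lra.
exists f; split=> //; apply: uniform_limit_continuous => d /complex_gt0[-> d0].
have [q _ qf] := approx _ d0.
exists (fun eta => poly_eval eta q).
  apply: (@lincomb_continuous R[i] _ G (fun g (eta : pontryagin R[i] G) => eta g)).
  exact: pontryagin_eval_continuous.
by move=> eta; rewrite normCE ltcR.
Qed.

(** For a polynomial V close to [v], the value of star V V - 1 at [eta] is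
    small because star V V is close to star v v = 1. *)
Lemma symbol_unimodular (v : A) (f : pontryagin R[i] G -> R[i]) : unitary v ->
  (forall e : R, 0 < e -> exists2 p, rnorm (v - poly_in u p) < e &
    forall eta, normc (poly_eval eta p - f eta) < e) ->
  forall eta, normc (f eta) = 1.
Proof.
move=> [v1 _] approx eta.
suff : `|normc (f eta) ^+ 2 - 1| <= 0.
  rewrite normr_le0 subr_eq0 => /eqP f1.
  by apply/eqP; rewrite -(@eqrXn2 _ 2)// ?normc_ge0// f1 expr1n.
apply: le0_of_eps => d d0.
pose e := Num.min 1 (d / 8).
have ep : 0 < e by rewrite lt_min ltr01 divr_gt0.
have e1 : e <= 1 by rewrite ge_min lexx.
have e8 : e <= d / 8 by rewrite ge_min lexx orbT.
have [p pv pf] := approx _ ep.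
set V := poly_in u p in pv; set z := poly_eval eta p.
have vn : rnorm v = 1 by exact: rnorm_isometry.
have Vn : rnorm V <= 2.
  by have := rnorm_triangle v V 0; rewrite !subr0 (rnorm_distC V) vn; lra.
have z2 : `|normc z ^+ 2 - 1| <= 3 * e.
  have -> : `|normc z ^+ 2 - 1| =
      normc (poly_eval eta (poly_mul (poly_star p) p ++ [:: (-1, 1%g)])).
    rewrite poly_eval_cat poly_eval_mul poly_eval_star -/z.
    rewrite /poly_eval big_seq1 char1 mulr1 mulrC -normCK normCE.
    by rewrite -rmorphXn -(rmorphN1 (real_complex R)) -rmorphD normc_real.
  rewrite (le_trans (poly_eval_le_rnorm hQ hads GC PC _ _))//.
  rewrite poly_in_cat (poly_in_mul (rel_uM rel)) (poly_in_star (star_u hQ)) -/V.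
  rewrite /poly_in big_seq1 (rel_u1 rel) scaleN1r -v1.
  have -> : star V * V - star v * v = star (V - v) * V + star v * (V - v).
    by rewrite starB mulrBl mulrBr addrA subrK.
  rewrite (le_trans (rnormD _ _))//.
  have := rnormM (star (V - v)) V; have := rnormM (star v) (V - v).
  rewrite !rnorm_star vn (rnorm_distC V) => h1 h2.
  have := rnorm_ge0 (v - V); have := rnorm_ge0 V; nra.
have zf : `|normc z - normc (f eta)| <= e.
  have := pf eta; rewrite -/z => h.
  have := le_normcD (z - f eta) (f eta); have := le_normcD (f eta - z) z.
  rewrite !subrK (normc_distC (f eta)) => h1 h2.
  by rewrite ler_norml; apply/andP; split; lra.
have zn : normc z <= 2.
  by rewrite (le_trans (poly_eval_le_rnorm hQ hads GC PC _ _)).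
move: z2 zf; rewrite !ler_norml => /andP[a1 a2] /andP[b1 b2].
have := normc_ge0 z; have := normc_ge0 (f eta) => c1 c2.
by apply/andP; split; nra.
Qed.

(** Let t_X = u_g s_p for g in the coset X and Phi(a) the sum of the
    t_X a (star t_X). By (III) the t_X (star t_X) add up to 1, so Phi(a) = b
    whenever s_p a = b s_p and b commutes with all u_g. Hence Phi maps u_g to
    u_(theta p g) and [v] to c v. Applied to polynomials that approximate [v]
    and evaluated at [eta], this is the functional equation. *)
Lemma symbol_functional_equation (v : A) (f : pontryagin R[i] G -> R[i])
    (p : P) (c : R[i]) :
  (forall e : R, 0 < e -> exists2 p, rnorm (v - poly_in u p) < e &
    forall eta, normc (poly_eval eta p - f eta) < e) ->
  finite_index theta p -> normc c = 1 -> (forall g, v * u g = u g * v) ->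
  s p * v = c *: (v * s p) ->
  forall eta, c * f eta = f (pdual_map (theta p) eta).
Proof.
move=> approx fin c1 vu sv eta.
pose t X := u (xget 1%g X) * s p.
pose Phi a := \sum_(X <- fset_set (cosets theta p)) t X * a * star (t X).
have sumt : \sum_(X <- fset_set (cosets theta p)) t X * star (t X) = 1.
  rewrite -(rel_III rel fin) fsbig_finite//=; apply: eq_bigr => X _.
  by rewrite starM !mulrA.
have Phi_twist a b : (forall g, b * u g = u g * b) -> s p * a = b * s p ->
    Phi a = b.
  move=> bu ab; rewrite -[RHS]mulr1 -sumt mulr_sumr; apply: eq_bigr => X _.
  by rewrite /t -(mulrA (u _)) ab !mulrA bu.
have Phi_u g : Phi (u g) = u (theta p g).
  apply: Phi_twist => [h|]; last exact: (rel_I rel).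
  by rewrite -!(rel_uM rel) GC.
have Phi_v : Phi v = c *: v.
  apply: Phi_twist => [g|]; first by rewrite -scalerAl -scalerAr vu.
  by rewrite sv scalerAl.
have PhiB a b : Phi (a - b) = Phi a - Phi b.
  rewrite /Phi -sumrB; apply: eq_bigr => X _.
  by rewrite mulrBr mulrBl.
have Phi_poly q : Phi (poly_in u q) = poly_in u (poly_map (theta p) q).
  rewrite /poly_in big_map /Phi.
  rewrite (eq_bigr (fun X => \sum_(x <- q) t X * (x.1 *: u x.2) * star (t X))); last first.
    by move=> X _; rewrite mulr_sumr mulr_suml.
  rewrite exchange_big; apply: eq_bigr => x _ /=.
  rewrite -Phi_u /Phi scaler_sumr; apply: eq_bigr => X _.
  by rewrite -scalerAr -scalerAl.
pose M := \sum_(X <- fset_set (cosets theta p)) rnorm (t X) * rnorm (t X).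
have M0 : 0 <= M by apply: sumr_ge0 => X _; rewrite mulr_ge0 ?rnorm_ge0.
have Phi_le a : rnorm (Phi a) <= M * rnorm a.
  rewrite /Phi /M; elim: (enum_fset _) => [|X r ih].
    by rewrite !big_nil rnorm0 mul0r.
  rewrite !big_cons mulrDl (le_trans (rnormD _ _))// lerD//.
  rewrite (le_trans (rnormM _ _))// rnorm_star mulrAC.
  by rewrite ler_wpM2r ?rnorm_ge0// rnormM.
have evalE q : poly_eval (pdual_map (theta p) eta) q =
    poly_eval eta (poly_map (theta p) q).
  by rewrite /poly_eval big_map.
apply/eqP; rewrite -subr_eq0; apply/eqP/eq0_normc/eqP.
rewrite eq_le normc_ge0 andbT; apply: le0_of_eps => d d0.
have ep : 0 < d / (M + 3) by rewrite divr_gt0// ltr_wpDl.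
have [q qv qf] := approx _ ep; set e := d / (M + 3) in ep qv qf.
have dE : d = M * e + 3 * e by rewrite -mulrDl mulrC divfK// gt_eqF// ltr_wpDl.
set V := poly_in u q in qv.
have mid : normc (c * poly_eval eta q - poly_eval (pdual_map (theta p) eta) q)
    <= e + M * e.
  rewrite evalE -mulN1r -!poly_eval_scale -poly_eval_cat.
  rewrite (le_trans (poly_eval_le_rnorm hQ hads GC PC _ _))//.
  rewrite poly_in_cat !poly_in_scale scaleN1r -Phi_poly -/V.
  rewrite (le_trans (rnorm_triangle (c *: v) _ _))// -scalerBr -Phi_v -PhiB.
  rewrite rnormZ c1 mul1r rnorm_distC lerD//; first exact: ltW.
  by rewrite (le_trans (Phi_le _))// ler_wpM2l// ltW.
have := qf (pdual_map (theta p) eta); have := qf eta.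
rewrite (normc_distC (poly_eval eta q)).
set z := poly_eval eta q in mid *; set z' := poly_eval _ q in mid *.
move=> h1 h2.
have := le_normcD (c * (f eta - z)) (c * z - f (pdual_map (theta p) eta)).
have := le_normcD (c * z - z') (z' - f (pdual_map (theta p) eta)).
rewrite normcM c1 mul1r mulrBr !addrA !subrK.
by rewrite dE; lra.
Qed.

End Symbol.

Theorem theorem6p15 (R : realType) (G : groupType) (P : monoidType)
    (theta : P -> {multiplicative G -> G})
    (A : cstarAlgType R[i]) (u : G -> A) (s : P -> A)
    (hads : algebraic_dynamical_system theta)
    (GC : commutative (@monoid.mul G)) (PC : commutative (@monoid.mul P))
    (hindex : exists p : P,
       finite_index theta p /\ (2 <= theta_index theta p)%N)
    (hQ : boundary_quotient theta u s)
    (hmax : maximal_abelian (cstar_generated (range u)))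
    (hchi : forall chi : pontryagin R[i] (grothendieck PC),
       (exists f : pontryagin R[i] G -> R[i],
          functional_equations theta chi f) ->
       chi = 1%g)
    (gamma : pontryagin R[i] (grothendieck PC) -> {lrmorphism A -> A})
    (hgamma : gauge_action u s gamma) :
  outer_action gamma.
Proof.
split; first exact: (gauge_group_action hQ hgamma).
move=> chi chi1 [w [wU gw]]; have [ww' w'w] := wU; apply/chi1/hchi.
pose D : set A := cstar_generated (range u).
have [[_ _ _ _ Dstar _] Dab _] := hmax.
have wu g : w * u g = u g * w.
  by rewrite -{2}(gauge_u hQ hgamma chi g) gw -mulrA ww' mulr1.
have w'u g : star w * u g = u g * star w.
  rewrite -[LHS]mulr1 -w'w mulrA -(mulrA (star w)) -wu.
  by rewrite mulrA ww' mul1r.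
have Dcomm : D `<=` commutant [set w; star w].
  apply: smallest_sub; last by move=> _ [g _ <-] y [->|->].
  by apply: commutant_cstar => x [->|->]; [right|left; exact: starK].
have Dw : D w.
  apply: (maximal_abelian_commutant hmax wU) => y Dy.
  by rewrite (Dcomm y Dy w)//; left.
have [f [fc approx]] := generated_symbol hQ hads GC PC (Dstar _ Dw).
(* The equation for the star of [w] has the factor [chi p], the one for [w]
   would have its conjugate. *)
have w'U : unitary (star w) by rewrite /unitary starK.
exists f; split=> // [eta|p fin].
  by rewrite normCE (symbol_unimodular hQ hads GC PC w'U approx).
apply: (symbol_functional_equation hQ hads GC PC approx fin) => //.
  by have [] := norm_char chi (groth_in PC p).
by rewrite scalerAr -(gauge_s hQ hgamma) gw !mulrA ww' mul1r.
Qed.
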